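(* Let $L_\infty$ be the division ring constructed in the context, i.e. the division subring of $D=K((G,\Phi))$ generated over $F=\mathbb{Q}((H))$ by all $\sqrt{p_i}$ and all $x_i$ ($i\ge 1$). Then: (i) $L_\infty$ is locally centrally finite. (ii) $L_\infty$ is strongly algebraic over its center. (iii) $L_\infty$ is not linear.
   Context: Construction. Let $G=\bigoplus_{i=1}^\infty\mathbb{Z}$, the group of integer sequences $(n_1,n_2,\ldots)$ with finitely many nonzero terms, and let $x_i\in G$ be the sequence with $1$ in position $i$ and $0$ elsewhere; $G$ is free abelian on the $x_i$. The operation of $G$ is written multiplicatively. Order $G$ totally (lexicographically): $(n_1,n_2,\ldots)<(m_1,m_2,\ldots)$ if $n_1<m_1$ or there is $k\ge 1$ with $n_1=m_1,\ldots,n_k=m_k$ and $n_{k+1}<m_{k+1}$. Let $p_1<p_2<\cdots$ be an infinite sequence of prime numbers and $K=\mathbb{Q}(\sqrt{p_1},\sqrt{p_2},\ldots)\subseteq\mathbb{R}$. For each $i$ let $f_i\colon K\to K$ be the $\mathbb{Q}$-automorphism with $f_i(\sqrt{p_i})=-\sqrt{p_i}$ and $f_i(\sqrt{p_j})=\sqrt{p_j}$ for $j\ne i$; these commute. For $x=(n_1,n_2,\ldots)\in G$ put $\Phi_x=\prod_i f_i^{n_i}\in \mathrm{Gal}(K/\mathbb{Q})$; $x\mapsto\Phi_x$ is a group homomorphism $\Phi$. Let $D=K((G,\Phi))$ be the set of formal sums $\alpha=\sum_{x\in G}a_x x$, $a_x\in K$, whose support $\mathrm{supp}(\alpha)=\{x\in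 G: a_x\neq 0\}$ is well-ordered, with operations $\sum a_x x+\sum b_x x=\sum (a_x+b_x)x$ and $(\sum a_x x)(\sum b_y y)=\sum_{z\in G}\big(\sum_{xy=z}a_x\Phi_x(b_y)\big)z$. This is a division ring (known), containing $K$ and $G$ in the obvious way. Let $H=\{x^2:x\in G\}$ and let $F=\mathbb{Q}((H))$ be the set of formal sums $\sum_{x\in H}a_x x$ with $a_x\in\mathbb{Q}$ and well-ordered support; $F$ is the center of $D$ (known). For $n\ge 1$ let $L_n=F(\sqrt{p_1},\ldots,\sqrt{p_n},x_1,\ldots,x_n)$ be the division subring of $D$ generated over $F$ by the listed elements, and $L_\infty=\bigcup_{n\ge1}L_n$. Definitions. For a division ring $E$ with center $Z$ and $S\subseteq E$, $Z(S)$ denotes the division subring of $E$ generated by $Z\cup S$. $E$ is centrally finite if it is a finite dimensional vector space over its center. $E$ is locally centrally finite if for every finite $S\subseteq E$, $Z(S)$ is finite dimensional over $Z$. $E$ is linear if it can be embedded in some centrally finite division ring. $E$ is algebraic over $Z$ if each element of $E$ is algebraic over $Z$. If $E$ is algebraic over its center $Z$, then $E$ is strongly algebraic over $Z$ if it contains a maximal subfield $M$ such that (i) there is a subset $S\subseteq M$ with $M=Z(S)$, and (ii) for each $x\in E$ there are at most finitely many $y\in S$ with $xy\ne yx$. *)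

(* Defs.v *)
From HB Require Import structures.
From mathcomp Require Import all_boot all_order all_algebra finmap.
From mathcomp Require Import boolp classical_sets functions cardinality fsbigop.
From mathcomp Require Import wochoice reals.

Set Implicit Arguments.
Unset Strict Implicit.
Unset Printing Implicit Defensive.

Import Order.TTheory GRing.Theory Num.Theory.

Local Open Scope classical_set_scope.
Local Open Scope ring_scope.

(* Finitely supported integer sequences, written additively although the group *)
(* is written multiplicatively inside the series ring: the monomial of x + y   *)
(* is the product of the monomials of x and y.                                 *)
Record expo := Expo {
  exponent :> nat -> int;
  expo_fin : `[< exists N, forall i, (N <= i)%N -> exponent i = 0 >] }.

HB.instance Definition _ := [isSub for exponent].
HB.instance Definition _ := [Choice of expo by <:].

Lemma expoP (x y : expo) : (forall i, x i = y i) <-> x = y.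
Proof. by split=> [xy|->//]; apply/val_inj/funext. Qed.

Lemma expo_zero_fin : `[< exists N, forall i, (N <= i)%N -> (0 : int) = 0 >].
Proof. by apply/asboolP; exists 0%N. Qed.

Lemma expo_opp_fin (x : expo) :
  `[< exists N, forall i, (N <= i)%N -> - x i = 0 >].
Proof.
case: x => x /= /asboolP[N xN]; apply/asboolP; exists N => i Ni.
by rewrite xN ?oppr0.
Qed.

Lemma expo_add_fin (x y : expo) :
  `[< exists N, forall i, (N <= i)%N -> x i + y i = 0 >].
Proof.
case: x y => x /= /asboolP[N xN] [y /= /asboolP[M yM]].
apply/asboolP; exists (maxn N M) => i; rewrite geq_max => /andP[Ni Mi].
by rewrite xN ?yM ?addr0.
Qed.

Definition expo_zero := Expo expo_zero_fin.
Definition expo_opp x := Expo (expo_opp_fin x).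
Definition expo_add x y := Expo (expo_add_fin x y).

Lemma expo_addA : associative expo_add.
Proof. by move=> x y z; apply/expoP => i /=; rewrite addrA. Qed.
Lemma expo_addC : commutative expo_add.
Proof. by move=> x y; apply/expoP => i /=; rewrite addrC. Qed.
Lemma expo_add0 : left_id expo_zero expo_add.
Proof. by move=> x; apply/expoP => i /=; rewrite add0r. Qed.
Lemma expo_addN : left_inverse expo_zero expo_opp expo_add.
Proof. by move=> x; apply/expoP => i /=; rewrite addNr. Qed.

HB.instance Definition _ :=
  GRing.isZmodule.Build expo expo_addA expo_addC expo_add0 expo_addN.

Lemma expoD (x y : expo) i : (x + y) i = x i + y i. Proof. by []. Qed.
Lemma expoN (x : expo) i : (- x) i = - x i. Proof. by []. Qed.
Lemma expo0 i : (0 : expo) i = 0. Proof. by []. Qed.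

Lemma expo_gen_fin i :
  `[< exists N, forall j, (N <= j)%N -> ((j == i)%:R : int) = 0 >].
Proof.
by apply/asboolP; exists i.+1 => j ij; rewrite (gtn_eqF ij).
Qed.

(* The i-th unit vector, i.e. the free generator x_i (indices start at 0). *)
Definition gen i := Expo (expo_gen_fin i).

Definition lex (x y : expo) :=
  exists k, (forall i, (i < k)%N -> x i = y i) /\ x k < y k.

Definition expo_lt (x y : expo) := `[< lex x y >].

Lemma expo_lt_irr : irreflexive expo_lt.
Proof. by move=> x; apply/asboolPn => -[k []]; rewrite ltxx. Qed.

Lemma expo_lt_trans : transitive expo_lt.
Proof.
move=> y x z /asboolP[k [xyk xyk1]] /asboolP[l [yzl yzl1]]; apply/asboolP.
have [kl|lk|kl] := ltngtP k l.
- exists k; split=> [i ik|]; last by rewrite -(yzl _ kl).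
  by rewrite xyk // yzl // (ltn_trans ik).
- exists l; split=> [i il|]; last by rewrite (xyk _ lk).
  by rewrite xyk ?yzl // (ltn_trans il).
- subst l; exists k; split=> [i ik|]; first by rewrite xyk ?yzl.
  exact: lt_trans yzl1.
Qed.

Fact expo_display : Order.disp_t. Proof. exact. Qed.

HB.instance Definition _ :=
  Order.Lt_isPOrder.Build expo_display expo expo_lt_irr expo_lt_trans.

Lemma expo_ltP (x y : expo) : reflect (lex x y) (x < y)%O.
Proof. exact: asboolP. Qed.

Lemma expo_le_total : total (<=%O : rel expo).
Proof.
move=> x y; have [->|/eqP xy] := eqVneq x y; first by rewrite lexx.
have ex : exists i, x i != y i.
  apply: contrapT => nex; apply: xy; apply/expoP => i; apply/eqP.
  by apply: contrapT => /negP xyi; apply: nex; exists i.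
case: (ex_minnP ex) => k xyk mink.
have lek i : (i < k)%N -> x i = y i.
  by move=> ik; apply/eqP; apply: contraTT ik => /mink; rewrite -leqNgt.
rewrite !le_eqVlt; case: (ltgtP (x k) (y k)) xyk => // xyk _.
- by apply/orP; left; apply/orP; right; apply/expo_ltP; exists k.
- apply/orP; right; apply/orP; right; apply/expo_ltP; exists k; split=> //.
  by move=> i /lek.
Qed.

HB.instance Definition _ := Order.POrder_isTotal.Build expo_display expo expo_le_total.

Lemma expo_ltD2r (z x y : expo) : (x + z < y + z)%O = (x < y)%O.
Proof.
have imp (u v w : expo) : (u < v)%O -> (u + w < v + w)%O.
  move=> /expo_ltP[k [eqk ltk]]; apply/expo_ltP; exists k; split=> [i /eqk|].
    by rewrite !expoD => ->.
  by rewrite !expoD ltrD2r.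
by apply/idP/idP=> [/(imp _ _ (- z))|/imp//]; rewrite !addrK.
Qed.

Lemma expo_ltD2l (z x y : expo) : (z + x < z + y)%O = (x < y)%O.
Proof. by rewrite ![z + _]addrC expo_ltD2r. Qed.

Notation wo_expo := (wo_chain (<=%O : rel expo)).

Section WellOrderedSets.
Implicit Types (A B : {pred expo}) (U : set expo).

Lemma set0_or U : U = set0 \/ U !=set0.
Proof. by have [->|/set0P] := eqVneq U set0; [left|right]. Qed.

Lemma wo_min A U : wo_expo A -> (forall x, U x -> x \in A) -> U !=set0 ->
  exists m, U m /\ forall x, U x -> (m <= x)%O.
Proof.
move=> woA UA [x Ux].
have [||m [[/asboolP Um minm] _]] := woA [pred x | `[< U x >]].
- by move=> y /asboolP; exact: UA.
- by exists x; apply/asboolP.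
- by exists m; split=> // y Uy; apply: minm; apply/asboolP.
Qed.

Lemma wo_intro A : (forall U, (forall x, U x -> x \in A) -> U !=set0 ->
    exists m, U m /\ forall x, U x -> (m <= x)%O) ->
  wo_expo A.
Proof.
move=> minA; apply: antisymmetric_wo_chain.
  by move=> x y _ _; exact: le_anti.
move=> C sCA [x Cx]; have [|| m [Cm minm]] := minA [set y | y \in C].
- by move=> y /=; apply: sCA.
- by exists x.
- by exists m; split=> // y Cy; apply: minm.
Qed.

Lemma wo_sub A B : {subset A <= B} -> wo_expo B -> wo_expo A.
Proof.
by move=> sAB woB; apply: wo_intro => U UA; apply: (wo_min woB) => x /UA/sAB.
Qed.

Lemma wo_union A B : wo_expo A -> wo_expo B ->
  wo_expo [pred x | (x \in A) || (x \in B)].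
Proof.
move=> woA woB; apply: wo_intro => U UAB [x0 Ux0].
have [[xA [xAA UxA]]|nA] := pselect (exists x, x \in A /\ U x); last first.
  apply: (wo_min woB) => [x Ux|]; last by exists x0.
  by have /orP[xA|//] := UAB _ Ux; case: nA; exists x.
have [[xB [xBB UxB]]|nB] := pselect (exists x, x \in B /\ U x); last first.
  apply: (wo_min woA) => [x Ux|]; last by exists x0.
  by have /orP[//|xB] := UAB _ Ux; case: nB; exists x.
have [||a [[aA Ua] mina]] := @wo_min A [set x | x \in A /\ U x] woA.
- by move=> x [].
- by exists xA.
have [||b [[bB Ub] minb]] := @wo_min B [set x | x \in B /\ U x] woB.
- by move=> x [].
- by exists xB.
have [ab|ba] := leP a b.
- exists a; split=> // x Ux; have /orP[xA'|xB'] := UAB _ Ux; first exact: mina.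
  by apply: le_trans ab _; apply: minb.
- exists b; split=> // x Ux; have /orP[xA'|xB'] := UAB _ Ux; last exact: minb.
  by apply: le_trans (ltW ba) _; apply: mina.
Qed.

Lemma wo1 (z : expo) : wo_expo (pred1 z).
Proof.
apply: wo_intro => U Uz [x Ux]; exists x; split=> // y Uy.
by rewrite (eqP (Uz _ Ux)) (eqP (Uz _ Uy)).
Qed.

Lemma minmax_finite U :
  (forall V, V `<=` U -> V !=set0 -> exists m, V m /\ forall x, V x -> (m <= x)%O) ->
  (forall V, V `<=` U -> V !=set0 -> exists m, V m /\ forall x, V x -> (x <= m)%O) ->
  finite_set U.
Proof.
move=> minU maxU; pose L x := U `&` [set y | (y <= x)%O].
have [->|[x0 Ux0]] := set0_or U; first exact: finite_set0.
have [||m [Um maxm]] := maxU U; [by []|by exists x0|].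
suff finL : forall x, U x -> finite_set (L x).
  apply: sub_finite_set (finL _ Um) => y Uy; split=> //; exact: maxm.
apply: contrapT => /existsNP[x /not_implyP[Ux nfx]].
have [||y [[Uy nfy] miny]] := minU [set x | U x /\ ~ finite_set (L x)].
- by move=> ? [].
- by exists x.
apply: nfy; pose V := U `&` [set z | (z < y)%O].
have [V0|[z0 Vz0]] := set0_or V.
  apply: (@sub_finite_set _ _ [set y]); last exact: finite_set1.
  move=> z [Uz /=]; rewrite le_eqVlt => /orP[/eqP//|zy].
  by have : V z by []; rewrite V0.
have [||z [[Uz /= zy] maxz]] := maxU V; [by move=> ? []|by exists z0|].
have fz : finite_set (L z).
  apply: contrapT => nfz; have : (y <= z)%O by apply: miny.
  by rewrite leNgt zy.
apply: (@sub_finite_set _ _ (L z `|` [set y])); last first.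
  by rewrite finite_setU; split=> //; exact: finite_set1.
move=> w [Uw /=]; rewrite le_eqVlt => /orP[/eqP->|wy]; first by right.
by left; split=> //; apply: maxz.
Qed.

Lemma seq_min (s : seq expo) : s != [::] ->
  exists m, m \in s /\ forall x, x \in s -> (m <= x)%O.
Proof.
elim: s => // a [|b s] IHs _.
  by exists a; split=> [|x]; rewrite inE // => /eqP->.
have [//|m [ms minm]] := IHs; have [am|ma] := leP a m.
- exists a; split=> [|x]; first by rewrite inE eqxx.
  by rewrite inE => /orP[/eqP->//|/minm]; apply: le_trans.
- exists m; split=> [|x]; first by rewrite inE ms orbT.
  by rewrite inE => /orP[/eqP->|/minm//]; apply: ltW.
Qed.

Definition sumset A B : {pred expo} :=
  [pred z | `[< exists x y, [/\ x \in A, y \in B & z = x + y] >]].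

Lemma wo_sumset A B :
  wo_expo A -> wo_expo B -> wo_expo (sumset A B).
Proof.
move=> woA woB; apply: wo_intro => S SAB S0.
pose P a b := [/\ a \in A, b \in B & S (a + b)].
pose R a b := P a b /\ forall b', P a b' -> (b <= b')%O.
have exR a b : P a b -> exists c, R a c /\ (c <= b)%O.
  move=> Pab; have [||c [Pac minc]] := @wo_min B [set b | P a b] woB.
  - by move=> ? [].
  - by exists b.
  - by exists c; split; [split|apply: minc].
have Runiq a b c : R a b -> R a c -> b = c.
  move=> [Pb minb] [Pc minc]; apply/le_anti/andP; split; [exact: minb|exact: minc].
pose T := [set a | exists b, R a b /\
  forall a' b', P a' b' -> (a' < a)%O -> (b < b')%O].
have redT a b : P a b -> exists t c, [/\ T t, R t c & (t + c <= a + b)%O].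
  move=> Pab.
  have [||t [[b0 [b0b Ptb0]] mint]] :=
      @wo_min A [set a' | exists b', (b' <= b)%O /\ P a' b'] woA.
  - by move=> ? [? [_ []]].
  - by exists a, b.
  have [c [Rtc cb0]] := exR _ _ Ptb0.
  have cb : (c <= b)%O by apply: le_trans b0b.
  exists t, c; split=> //.
    exists c; split=> // a' b' Pab' ta; rewrite ltNge; apply/negP => b'c.
    have : (t <= a')%O by apply: mint; exists b'; split=> //; apply: le_trans cb.
    by rewrite leNgt ta.
  have ta : (t <= a)%O by apply: mint; exists b.
  apply: (@le_trans _ _ (t + b)).
    by move: cb; rewrite !le_eqVlt expo_ltD2l => /orP[/eqP->|->]; rewrite ?eqxx ?orbT.
  by move: ta; rewrite !le_eqVlt expo_ltD2r => /orP[/eqP->|->]; rewrite ?eqxx ?orbT.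
have finT : finite_set T.
  apply: minmax_finite => V VT V0.
    by apply: (wo_min woA) => // x /VT [b [[[]]]].
  have [||b [[a [Va Rab]] minb]] := @wo_min B [set b | exists a, V a /\ R a b] woB.
  - by move=> b [a [_ [[]]]].
  - by have [a Va] := V0; have [b [Rab _]] := VT _ Va; exists b, a.
  exists a; split=> // x Vx; rewrite leNgt; apply/negP => ax.
  have [b' [Rxb' Tx]] := VT _ Vx; have := Tx a b (proj1 Rab) ax.
  by rewrite ltNge minb //; exists x.
pose f a := xget 0 [set b | R a b].
have fR a b : R a b -> f a = b.
  by move=> Rab; apply: xget_unique => // c Rac; exact: Runiq Rac Rab.
have [s Ts] : exists s : seq expo, forall a, T a <-> a \in s.
  have /finite_seqP[s Ts] := finT; exists s => a; by rewrite Ts.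
have [s0 Ss0] := S0; have /asboolP[a0 [b0 [a0A b0B s0E]]] := SAB _ Ss0.
have [|t0 [c0 [Tt0 Rt0 _]]] := redT a0 b0; first by split=> //; rewrite -s0E.
have [|m [/mapP[t ts ->] minm]] := @seq_min [seq a + f a | a <- s].
  by case: (s) (proj1 (Ts _) Tt0).
have [c [Rtc _]] : T t by apply/Ts.
exists (t + f t); split; first by rewrite (fR _ _ Rtc); have [[]] := Rtc.
move=> x Sx; have /asboolP[a [b [aA bB xE]]] := SAB _ Sx.
have [|t' [c' [Tt' Rt' le']]] := redT a b; first by split=> //; rewrite -xE.
rewrite xE; apply: le_trans le'; rewrite -(fR _ _ Rt'); apply: minm.
by apply/mapP; exists t' => //; apply/Ts.
Qed.

Lemma fiber_finite A B z : wo_expo A -> wo_expo B ->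
  finite_set [set x | x \in A /\ z - x \in B].
Proof.
move=> woA woB; apply: minmax_finite => V VT [v0 Vv0].
  by apply: (wo_min woA) => [x /VT[]//|]; exists v0.
have [||b [Vb minb]] := @wo_min B [set b | V (z - b)] woB.
- by move=> b /VT[_]; rewrite opprB addrC subrK.
- by exists (z - v0); rewrite /= opprB addrC subrK.
exists (z - b); split=> // x Vx; have : (b <= z - x)%O.
  by apply: minb; rewrite /= opprB addrC subrK.
rewrite [(b <= _)%O]le_eqVlt [(x <= _)%O]le_eqVlt => /orP[/eqP->|].
  by rewrite opprB addrC subrK eqxx.
rewrite -(expo_ltD2r (x - b)) [b + _]addrC subrK [z - x + _]addrA subrK => ->.
by rewrite orbT.
Qed.

Lemma fiber_fset A B z : wo_expo A -> wo_expo B ->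
  exists X : {fset expo}, forall x, x \in A -> z - x \in B -> x \in X.
Proof.
move=> woA woB; exists (fset_set [set x | x \in A /\ z - x \in B]) => x xA xB.
by rewrite in_fset_set ?inE //; exact: fiber_finite.
Qed.

End WellOrderedSets.
Arguments wo1 : clear implicits.
Arguments fiber_fset {A B} z _ _.

HB.mixin Record UnitRing_isDivRing R of GRing.UnitRing R := {
  neq0_unit : forall x : R, x != 0 -> x \is a GRing.unit }.

#[short(type="divRingType")]
HB.structure Definition DivRing :=
  {R of UnitRing_isDivRing R & GRing.UnitRing R}.

(* A homomorphism from the exponent group to the automorphisms of K; the       *)
(* bijectivity of each twist_fun x follows from the two axioms.                *)
Record twist (K : fieldType) := Twist {
  twist_fun :> expo -> {rmorphism K -> K};
  twist0 : forall a, twist_fun 0 a = a;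
  twistD : forall x y a, twist_fun (x + y) a = twist_fun x (twist_fun y a) }.

Record series (K : fieldType) (Phi : twist K) := Series {
  coef :> expo -> K;
  coef_wo : `[< wo_expo [pred x | coef x != 0] >] }.

HB.instance Definition _ (K : fieldType) (Phi : twist K) := [isSub for (@coef K Phi)].
HB.instance Definition _ (K : fieldType) (Phi : twist K) := [Choice of series Phi by <:].

Section Series.
Variables (K : fieldType) (Phi : twist K).
Local Notation S := (series Phi).
Implicit Types (a b c : S).

Definition supp a : {pred expo} := [pred x | a x != 0].

Lemma supp_wo a : wo_expo (supp a).
Proof. exact: (asboolW (coef_wo a)). Qed.
Arguments supp_wo : clear implicits.

Lemma seriesP a b : (forall x, a x = b x) <-> a = b.
Proof. by split=> [ab|->//]; apply/val_inj/funext. Qed.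

Lemma zero_wo : `[< wo_expo [pred x : expo | (0 : K) != 0] >].
Proof.
by apply/asboolP/wo_intro => U U0 [x /U0]; rewrite inE /= eqxx.
Qed.

Lemma opp_wo a : `[< wo_expo [pred x | - a x != 0] >].
Proof.
by apply/asboolP; apply: (wo_sub _ (supp_wo a)) => x; rewrite !inE oppr_eq0.
Qed.

Lemma add_wo a b : `[< wo_expo [pred x | a x + b x != 0] >].
Proof.
apply/asboolP; apply: (wo_sub _ (wo_union (supp_wo a) (supp_wo b))) => x.
rewrite !inE; apply: contraNT; rewrite negb_or !negbK => /andP[/eqP-> /eqP->].
by rewrite addr0.
Qed.

Lemma mono_wo (k : K) z : `[< wo_expo [pred x | (if x == z then k else 0) != 0] >].
Proof.
apply/asboolP; apply: (wo_sub _ (wo1 z)) => x; rewrite -!topredE /=.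
by case: ifP; rewrite ?eqxx.
Qed.

(* The sum runs over the pairs (x, y) with x + y = z, i.e. y = z - x; it has  *)
(* finitely many nonzero terms.                                               *)
Definition mul_coef a b (z : expo) : K :=
  \sum_(x \in [set: expo]) a x * Phi x (b (z - x)).

Lemma mul_coefE a b z (X : {fset expo}) :
  (forall x, a x != 0 -> b (z - x) != 0 -> x \in X) ->
  mul_coef a b z = \sum_(x <- X) a x * Phi x (b (z - x)).
Proof.
move=> abX; apply: fsbigTE => x; apply: contraNeq => abx; apply: abX.
  by apply: contraNneq abx => ->; rewrite mul0r.
by apply: contraNneq abx => ->; rewrite rmorph0 mulr0.
Qed.

Lemma mul_coef_neq0 a b z : mul_coef a b z != 0 ->
  exists x, a x != 0 /\ b (z - x) != 0.
Proof.
move=> abz; apply: contrapT => nab; case/eqP: abz.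
rewrite (mul_coefE (X := fset0)) ?big_seq_fset0 // => x ax bx.
by case: nab; exists x.
Qed.

Lemma mul_wo a b : `[< wo_expo [pred z | mul_coef a b z != 0] >].
Proof.
apply/asboolP; apply: (wo_sub _ (wo_sumset (supp_wo a) (supp_wo b))) => z.
move=> /mul_coef_neq0[x [ax bx]]; apply/asboolP; exists x, (z - x).
by split=> //; rewrite addrC subrK.
Qed.

Definition zero_series : S := Series Phi zero_wo.
Definition opp_series a : S := Series Phi (opp_wo a).
Definition add_series a b : S := Series Phi (add_wo a b).
Definition monomial (k : K) (z : expo) : S := Series Phi (mono_wo k z).
Definition mul_series a b : S := Series Phi (mul_wo a b).

Lemma add_seriesA : associative add_series.
Proof. by move=> a b c; apply/seriesP => x /=; rewrite addrA. Qed.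
Lemma add_seriesC : commutative add_series.
Proof. by move=> a b; apply/seriesP => x /=; rewrite addrC. Qed.
Lemma add_series0 : left_id zero_series add_series.
Proof. by move=> a; apply/seriesP => x /=; rewrite add0r. Qed.
Lemma add_seriesN : left_inverse zero_series opp_series add_series.
Proof. by move=> a; apply/seriesP => x /=; rewrite addNr. Qed.

HB.instance Definition _ :=
  GRing.isZmodule.Build S add_seriesA add_seriesC add_series0 add_seriesN.

Lemma coefD a b x : (a + b) x = a x + b x. Proof. by []. Qed.
Lemma coefN a x : (- a) x = - a x. Proof. by []. Qed.
Lemma coefB a b x : (a - b) x = a x - b x. Proof. by []. Qed.
Lemma coef0 x : (0 : S) x = 0. Proof. by []. Qed.

Lemma mul_fset a b z : exists X : {fset expo},
  forall x, a x != 0 -> b (z - x) != 0 -> x \in X.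
Proof. exact: (fiber_fset z (supp_wo a) (supp_wo b)). Qed.

Lemma mul_seriesA : associative mul_series.
Proof.
move=> a b c; apply/seriesP => z /=.
have [U aU] := fiber_fset z (supp_wo a) (supp_wo (mul_series b c)).
have [U' aU'] := fiber_fset z (supp_wo a) (wo_sumset (supp_wo b) (supp_wo c)).
have [X abX] := fiber_fset z (wo_sumset (supp_wo a) (supp_wo b)) (supp_wo c).
have [X' abX'] := mul_fset (mul_series a b) c z.
rewrite (mul_coefE (X := (U `|` U')%fset)); last first.
  by move=> x ax bcx; rewrite in_fsetU aU.
rewrite (mul_coefE (X := (X `|` X')%fset)); last first.
  by move=> x abx cx; rewrite in_fsetU abX' ?orbT.
set U2 := (U `|` U')%fset; set X2 := (X `|` X')%fset.
transitivity (\sum_(u <- U2) \sum_(x <- X2)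
    a u * Phi u (b (x - u)) * Phi x (c (z - x))).
  apply: eq_bigr => u _ /=.
  have [->|au] := eqVneq (a u) 0.
    by rewrite mul0r big1 // => x _; rewrite !mul0r.
  rewrite (mul_coefE (X := [fset x - u | x in X2]%fset)); last first.
    move=> y by0 cy; apply/imfsetP; exists (u + y); last by rewrite addrC addKr.
    rewrite in_fsetU abX //; last by rewrite opprD addrA.
    by apply/asboolP; exists u, y.
  rewrite big_imfset /=; last by move=> x y _ _; apply: addIr.
  rewrite rmorph_sum mulr_sumr; apply: eq_bigr => x _.
  rewrite rmorphM mulrA -twistD [u + _]addrC subrK; congr (_ * Phi x (c _)).
  by rewrite opprB addrA subrK.
rewrite exchange_big; apply: eq_bigr => x _ /=.
have [->|cx] := eqVneq (c (z - x)) 0.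
  by rewrite rmorph0 mulr0 big1 // => u _; rewrite mulr0.
rewrite -mulr_suml; congr (_ * _); rewrite (mul_coefE (X := U2)) // => u au bu.
rewrite in_fsetU [u \in U']aU' ?orbT //; apply/asboolP; exists (x - u), (z - x).
by split=> //; rewrite [RHS]addrC addrA subrK.
Qed.

Lemma mul_1series : left_id (monomial 1 0) mul_series.
Proof.
move=> a; apply/seriesP => z /=; rewrite (mul_coefE (X := [fset 0]%fset)).
  by rewrite big_seq_fset1 /= eqxx mul1r twist0 subr0.
by move=> x /=; rewrite inE; case: ifP => //; rewrite eqxx.
Qed.

Lemma mul_series1 : right_id (monomial 1 0) mul_series.
Proof.
move=> a; apply/seriesP => z /=; rewrite (mul_coefE (X := [fset z]%fset)).
  by rewrite big_seq_fset1 /= subrr eqxx rmorph1 mulr1.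
move=> x _ /=; rewrite inE; case: ifP; last by rewrite eqxx.
by rewrite subr_eq0 eq_sym.
Qed.

Lemma mul_seriesDl : left_distributive mul_series add_series.
Proof.
move=> a b c; apply/seriesP => z /=.
have [X aX] := mul_fset a c z; have [Y bY] := mul_fset b c z.
rewrite !(mul_coefE (X := (X `|` Y)%fset)) -?big_split /=.
- by apply: eq_bigr => x _; rewrite mulrDl.
- by move=> x bx cx; rewrite in_fsetU bY ?orbT.
- by move=> x ax cx; rewrite in_fsetU aX.
- move=> x /= abx cx; rewrite in_fsetU; have [ax|ax] := eqVneq (a x) 0.
    by rewrite bY ?orbT //; move: abx; rewrite ax add0r.
  by rewrite aX.
Qed.

Lemma mul_seriesDr : right_distributive mul_series add_series.
Proof.
move=> a b c; apply/seriesP => z /=.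
have [X aX] := mul_fset a b z; have [Y bY] := mul_fset a c z.
rewrite !(mul_coefE (X := (X `|` Y)%fset)) -?big_split /=.
- by apply: eq_bigr => x _; rewrite rmorphD mulrDr.
- by move=> x bx cx; rewrite in_fsetU bY ?orbT.
- by move=> x ax cx; rewrite in_fsetU aX.
- move=> x /= ax bcx; rewrite in_fsetU; have [bx|bx] := eqVneq (b (z - x)) 0.
    by rewrite bY ?orbT //; move: bcx; rewrite bx add0r.
  by rewrite aX.
Qed.

Lemma one_series_neq0 : monomial 1 0 != 0 :> S.
Proof.
by apply/eqP => /seriesP/(_ 0) /=; rewrite eqxx => /eqP; rewrite oner_eq0.
Qed.

HB.instance Definition _ := GRing.Zmodule_isNzRing.Build S mul_seriesA
  mul_1series mul_series1 mul_seriesDl mul_seriesDr one_series_neq0.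

Lemma coef1 x : (1 : S) x = if x == 0 then 1 else 0. Proof. by []. Qed.
Lemma coefM a b z :
  (a * b) z = \sum_(x \in [set: expo]) a x * Phi x (b (z - x)).
Proof. by []. Qed.

End Series.
Arguments supp_wo {K Phi} a.

Section SeriesDivision.
Variables (K : fieldType) (Phi : twist K).
Local Notation S := (series Phi).
Implicit Types (a b g h : S) (v w x y z : expo).

Definition leading a v := a v != 0 /\ forall x, (x < v)%O -> a x = 0.

Lemma leading_ex a : a != 0 -> exists v, leading a v.
Proof.
move=> /eqP a0; have [||v [av minv]] := @wo_min _ [set x | a x != 0] (supp_wo a).
- by [].
- apply: contrapT => nx; apply: a0; apply/seriesP => x; apply/eqP.
  by apply: contrapT => /negP ax; apply: nx; exists x.
- exists v; split=> // x xv; apply/eqP; apply: contraTT xv => ax.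
  by rewrite -leNgt; apply: minv.
Qed.

Lemma expo_ltBr x y z : (x < y - z)%O = (z + x < y)%O.
Proof. by rewrite -(expo_ltD2r z) subrK addrC. Qed.

Lemma mul_below a h v x : leading a v -> (forall y, (y < x)%O -> h y = 0) ->
  forall y, (y < v + x)%O -> (a * h) y = 0.
Proof.
move=> [_ av] hx y yvx; apply/eqP; apply: contraT => /mul_coef_neq0[u [au hu]].
have vu : (v <= u)%O by rewrite leNgt; apply: contra_neqN au; exact: av.
have xyu : (x <= y - u)%O by rewrite leNgt; apply: contra_neqN hu; exact: hx.
have : (y < y)%O; last by rewrite ltxx.
apply: (lt_le_trans yvx); apply: (@le_trans _ _ (u + x)).
  by move: vu; rewrite !le_eqVlt expo_ltD2r => /orP[/eqP->|->]; rewrite ?eqxx ?orbT.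
move: xyu; rewrite !le_eqVlt expo_ltBr => /orP[/eqP->|->]; rewrite ?orbT //.
by rewrite addrC subrK eqxx.
Qed.

Lemma mul_lead a h v x : leading a v -> (forall y, (y < x)%O -> h y = 0) ->
  (a * h) (v + x) = a v * Phi v (h x).
Proof.
move=> [_ av] hx; rewrite coefM -[LHS]/(mul_coef a h (v + x)).
rewrite (mul_coefE (X := [fset v]%fset)).
  by rewrite big_seq_fset1 addrC addrA addNr add0r.
move=> u au hu; rewrite in_fset1.
have vu : (v <= u)%O by rewrite leNgt; apply: contra_neqN au; exact: av.
have xyu : (x <= v + x - u)%O.
  by rewrite leNgt; apply: contra_neqN hu; exact: hx.
move: vu; rewrite le_eqVlt eq_sym => /orP[//|vu].
move: xyu; rewrite leNgt -(expo_ltD2r u) subrK [v + x]addrC expo_ltD2l.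
by rewrite vu.
Qed.

(* h is an initial segment of g. *)
Definition initial h g := forall x, h x != 0 -> forall y, (y <= x)%O -> g y = h y.

Section Solve.
Variables (a : S) (v : expo) (b : S).
Hypothesis av : leading a v.

(* The solution g of a * g = b is the union of the chain of all partial         *)
(* solutions g that are exact up to each of their own exponents.                *)
Definition greedy g :=
  forall x, g x != 0 -> forall y, (y <= v + x)%O -> (a * g) y = b y.

Lemma greedy_initial g h x : greedy g -> greedy h -> g x != 0 -> h x != g x ->
  (forall y, (y < x)%O -> g y = h y) -> initial h g.
Proof.
move=> gg gh gx hgx eqgh.
have hx y : (x <= y)%O -> h y = 0.
  move=> xy; apply/eqP; apply: contraT => hy; move: hgx; rewrite eq_sym -subr_eq0.
  have := @mul_lead a (g - h) v x av; rewrite coefB => E.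
  have {}E : (a * (g - h)) (v + x) = a v * Phi v (g x - h x).
    by apply: E => z zx; rewrite coefB eqgh // subrr.
  rewrite mulrBr coefB (gg x gx) // (gh y hy) ?subrr in E; last first.
    move: xy; rewrite !le_eqVlt expo_ltD2l => /orP[/eqP->|->]; rewrite ?orbT //.
    by rewrite eqxx.
  by move/esym/eqP: E; rewrite mulf_eq0 (negPf (proj1 av)) fmorph_eq0 /= => ->.
move=> z hz y yz; apply: eqgh; rewrite ltNge; apply: contraTN hz => /le_trans.
by move=> /(_ _ yz) /hx ->; rewrite eqxx.
Qed.

Lemma greedy_chain g h : greedy g -> greedy h -> initial h g \/ initial g h.
Proof.
move=> gg gh; have [->|] := eqVneq g h; first by left.
rewrite -subr_eq0 => /leading_ex[x [gx eqgh]].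
have {}eqgh y : (y < x)%O -> g y = h y.
  by move=> /eqgh /eqP; rewrite coefB subr_eq0 => /eqP.
rewrite coefB subr_eq0 in gx.
have [gx0|gx0] := eqVneq (g x) 0.
  right; apply: (greedy_initial gh gg _ gx) => [|y /eqgh //].
  by rewrite -gx0 eq_sym.
by left; apply: (greedy_initial gg gh gx0 _ eqgh); rewrite eq_sym.
Qed.

Definition limit_coef x : K :=
  xget 0 [set k | k != 0 /\ exists g, greedy g /\ g x = k].

Lemma greedy_agree g h x y : greedy g -> greedy h -> g x != 0 -> (y <= x)%O ->
  h y != 0 -> g y = h y.
Proof.
move=> gg gh gx yx hy; have [hg|gh'] := greedy_chain gg gh.
  exact: hg hy _ (lexx _).
by rewrite (gh' _ gx _ yx).
Qed.

Lemma limit_coefE g x y : greedy g -> g x != 0 -> (y <= x)%O ->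
  limit_coef y = g y.
Proof.
move=> gg gx yx; rewrite /limit_coef; case: xgetP => [k _ [k0 [h [gh hk]]]|no].
  by rewrite -hk; apply/esym/(greedy_agree gg gh gx yx); rewrite hk.
apply/esym/eqP; apply: contraT => gy; case: (no (g y)); split=> //.
by exists g.
Qed.

Lemma limit_coef_neq0 x : limit_coef x != 0 -> exists g, greedy g /\ g x != 0.
Proof.
rewrite /limit_coef; case: xgetP => [k _ [k0 [g [gg gk]]] _|]; last by rewrite eqxx.
by exists g; rewrite gk.
Qed.

Lemma limit_wo : `[< wo_expo [pred x | limit_coef x != 0] >].
Proof.
apply/asboolP/wo_intro => U Ulim [x Ux].
have [g [gg gx]] := limit_coef_neq0 (Ulim _ Ux).
have [||m [[Um mx] minm]] :=
    @wo_min _ [set y | U y /\ (y <= x)%O] (supp_wo g).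
- by move=> y [/Ulim + yx]; rewrite -!topredE /= (limit_coefE gg gx yx).
- by exists x; split=> //=.
- exists m; split=> // y Uy; have [yx|xy] := leP y x; first exact: minm.
  exact: le_trans mx (ltW xy).
Qed.

Definition limit : S := Series Phi limit_wo.

Lemma limit_greedy : greedy limit.
Proof.
move=> x /limit_coef_neq0[g [gg gx]] y yx; rewrite -(gg x gx y yx).
have [->//|] := eqVneq limit g; rewrite -subr_eq0 => /leading_ex[u [lu gu]].
have xu : (x < u)%O.
  rewrite ltNge; apply: contraNN lu => ux.
  by rewrite coefB [limit u](limit_coefE gg gx ux) subrr.
apply/eqP; rewrite -subr_eq0 -coefB -mulrBr; apply/eqP.
by apply: (mul_below av gu); apply: le_lt_trans yx _; rewrite expo_ltD2l.
Qed.

Lemma solve : a * limit = b.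
Proof.
apply/esym/eqP; rewrite -subr_eq0; apply: contraT => /leading_ex[w [bw ltw]].
pose x := w - v; have wE : w = v + x by rewrite addrC subrK.
have xlim y : limit y != 0 -> (y < x)%O.
  move=> ly; rewrite -(expo_ltD2l v) -wE ltNge; apply: contraNN bw => wy.
  by rewrite coefB (limit_greedy ly) ?subrr.
pose k := Phi (- v) ((a v)^-1 * (b - a * limit) w).
have Pk : a v * Phi v k = (b - a * limit) w.
  by rewrite /k -twistD subrr twist0 mulVKf //; exact: (proj1 av).
have k0 : k != 0.
  by apply: contraNneq bw => k0; rewrite -Pk k0 rmorph0 mulr0.
pose g := limit + monomial Phi k x.
have mono_lt y : (y < x)%O -> monomial Phi k x y = 0.
  by move=> yx /=; rewrite (lt_eqF yx).
have gx : g x = k.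
  rewrite coefD /= eqxx; have [->|/xlim] := eqVneq (limit_coef x) 0.
    by rewrite add0r.
  by rewrite ltxx.
have below y : (y < w)%O -> (a * g) y = b y.
  move=> yw; rewrite mulrDr coefD (mul_below av mono_lt) -?wE // addr0.
  by apply/esym/eqP; rewrite -subr_eq0 -coefB ltw.
have gg : greedy g.
  move=> z gz y; have [->|zx] := eqVneq z x.
    rewrite -wE le_eqVlt => /orP[/eqP->|]; last exact: below.
    rewrite mulrDr coefD {2}wE (mul_lead av mono_lt) /= eqxx Pk coefB.
    by rewrite addrC subrK.
  move=> yz; apply: below; apply: le_lt_trans yz _; rewrite wE expo_ltD2l.
  by apply: xlim; move: gz; rewrite coefD /= (negPf zx) addr0.
have : (x < x)%O; last by rewrite ltxx.
by apply: xlim; rewrite /= (limit_coefE gg _ (lexx x)) gx.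
Qed.

End Solve.

Lemma series_rinv a : a != 0 -> exists b, a * b = 1.
Proof.
by move=> /leading_ex[v av]; exists (limit 1 av); exact: solve.
Qed.

Definition inv_series a : S :=
  if a == 0 then a else xget 0 [set b | a * b = 1].

Lemma mul_series_inv : {in [pred a | a != 0], right_inverse 1 inv_series *%R}.
Proof.
move=> a; rewrite inE => a0; rewrite /inv_series (negPf a0).
by case: xgetP => [b _ //|no]; have [b /no] := series_rinv a0.
Qed.

Lemma mul_inv_series : {in [pred a | a != 0], left_inverse 1 inv_series *%R}.
Proof.
move=> a a0; have ab := mul_series_inv a0; move: (inv_series a) ab => b ab.
have b0 : b != 0.
  by apply: contra_eq_neq ab => ->; rewrite mulr0 eq_sym oner_neq0.
have [c bc] := series_rinv b0.
by rewrite -[a](mulr1 a) -bc [a * _]mulrA ab mul1r.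
Qed.

Lemma series_unitP a b : b * a = 1 /\ a * b = 1 -> a \in [pred a : S | a != 0].
Proof.
move=> [ba _]; rewrite inE; apply: contra_eq_neq ba => ->.
by rewrite mulr0 eq_sym oner_neq0.
Qed.

Lemma inv_series_out : {in [predC [pred a : S | a != 0]], inv_series =1 id}.
Proof. by move=> a; rewrite !inE negbK /inv_series => ->. Qed.

HB.instance Definition _ := GRing.NzRing_hasMulInverse.Build S
  mul_inv_series mul_series_inv series_unitP inv_series_out.

Lemma series_unit a : a != 0 -> a \is a GRing.unit.
Proof. by []. Qed.

HB.instance Definition _ := UnitRing_isDivRing.Build S series_unit.

End SeriesDivision.

Section Generation.
Variable E : unitRingType.
Implicit Types S A : set E.

Definition divsubring A := GRing.divring_closed (mem A).

Definition divgen S : set E := smallest divsubring S.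

Lemma divgen_sub S : S `<=` divgen S.
Proof. exact: sub_smallest. Qed.

Lemma divgen_closed S : divsubring (divgen S).
Proof.
split; first by rewrite inE => A [[A1 _ _] _]; rewrite inE in A1.
- move=> x y; rewrite !inE => Sx Sy A AS; have [[_ AB _] _] := AS.
  by have := AB x y; rewrite !inE; apply; [exact: Sx|exact: Sy].
- move=> x y; rewrite !inE => Sx Sy A AS; have [[_ _ AV] _] := AS.
  by have := AV x y; rewrite !inE; apply; [exact: Sx|exact: Sy].
Qed.

Lemma divgen_min S A : divsubring A -> S `<=` A -> divgen S `<=` A.
Proof. by move=> Acl SA; apply: smallest_sub. Qed.

Lemma divgen_le S A : S `<=` A -> divgen S `<=` divgen A.
Proof. by move=> SA; apply: sub_smallest2r => //; exact: divgen_closed. Qed.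

End Generation.

Section DivisionRings.
Variable E : divRingType.
Implicit Types S V M N : set E.

Definition center : set E := [set z | forall x, z * x = x * z].

Definition center_gen S : set E := divgen (center `|` S).

(* V is finite dimensional over the center, i.e. it has a finite spanning      *)
(* family with coefficients in the center; V is always meant to be closed      *)
(* under addition and under multiplication by the center.                      *)
Definition center_findim V :=
  exists b : seq E, (forall x, x \in b -> V x) /\
    forall x, V x -> exists c : nat -> E,
      (forall i, center (c i)) /\ x = \sum_(i < size b) c i * b`_i.

Definition centrally_finite := center_findim [set: E].

Definition locally_centrally_finite :=
  forall S, finite_set S -> center_findim (center_gen S).

Definition center_algebraic (x : E) :=
  exists q : {poly E}, [/\ q != 0, forall i, center q`_i & root q x].

Definition subfield M :=
  divsubring M /\ forall x y, M x -> M y -> x * y = y * x.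

Definition maximal_subfield M :=
  subfield M /\ forall N, subfield N -> M `<=` N -> N = M.

Definition strongly_algebraic :=
  (forall x, center_algebraic x) /\
  exists M, maximal_subfield M /\
    exists S, [/\ S `<=` M, M = center_gen S &
      forall x, finite_set [set y | S y /\ x * y <> y * x]].

End DivisionRings.

Definition linear_divring (E : divRingType) :=
  exists T : divRingType, centrally_finite T /\
    exists f : {rmorphism E -> T}, injective f.

Record aut (K : fieldType) := Aut {
  aut_fun :> {rmorphism K -> K};
  aut_inv : {rmorphism K -> K};
  aut_funK : cancel aut_fun aut_inv;
  aut_invK : cancel aut_inv aut_fun }.

Section GaloisTwist.
Variable K : fieldType.
Implicit Types (s t : aut K) (n m : int).

Definition autz s n : K -> K :=
  match n with Posz k => iter k s | Negz k => iter k.+1 (aut_inv s) end.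

Lemma iter_zmod (g : {rmorphism K -> K}) k : zmod_morphism (iter k g).
Proof. by move=> a b; elim: k => //= k ->; rewrite rmorphB. Qed.

Lemma iter_monoid (g : {rmorphism K -> K}) k : monoid_morphism (iter k g).
Proof.
split; first by elim: k => //= k ->; rewrite rmorph1.
by move=> a b; elim: k => //= k ->; rewrite rmorphM.
Qed.

Lemma autz_zmod s n : zmod_morphism (autz s n).
Proof. by case: n => k; exact: iter_zmod. Qed.

Lemma autz_monoid s n : monoid_morphism (autz s n).
Proof. by case: n => k; exact: iter_monoid. Qed.

Lemma autzS s n a : autz s (n + 1) a = s (autz s n a).
Proof.
case: n => [k|[|k]]; first by rewrite -[1]/(Posz 1) -PoszD addn1.
  by rewrite /= aut_invK.
transitivity (autz s (Negz k) a); last by rewrite /= aut_invK.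
congr (autz s _ a).
by rewrite !NegzE -[k.+2]addn1 PoszD opprD addrNK.
Qed.

Lemma autzP s n a : autz s (n - 1) a = aut_inv s (autz s n a).
Proof. by rewrite -{2}[n](subrK 1) autzS aut_funK. Qed.

Lemma autzD s n m a : autz s (n + m) a = autz s n (autz s m a).
Proof.
elim/int_rect: n => [|n IHn|n IHn]; first by rewrite add0r.
  by rewrite -addn1 PoszD addrAC !autzS IHn.
by rewrite -addn1 PoszD opprD addrAC !autzP IHn.
Qed.

Lemma autz_comm (g : K -> K) s n : (forall a, g (s a) = s (g a)) ->
  forall a, g (autz s n a) = autz s n (g a).
Proof.
move=> gs; have gi a : g (aut_inv s a) = aut_inv s (g a).
  by rewrite -[in RHS](aut_invK s a) gs aut_funK.
elim/int_rect: n => [|n IHn|n IHn] a //.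
  by rewrite -addn1 PoszD !autzS gs IHn.
by rewrite -addn1 PoszD opprD !autzP gi IHn.
Qed.

Variable f : nat -> aut K.

(* Some bound on the support of x; by prod_aut_width its choice is irrelevant. *)
Definition width (x : expo) :=
  xget 0%N [set N | forall i, (N <= i)%N -> x i = 0].

Lemma widthP x i : (width x <= i)%N -> x i = 0.
Proof.
rewrite /width; case: xgetP => [N _ xN|no]; first exact: xN.
by have /asboolP[N xN] := expo_fin x; case: (no N).
Qed.

(* f_0 ^ x_0 o ... o f_(N-1) ^ x_(N-1) *)
Definition prod_aut N (x : expo) : K -> K :=
  fun a => foldr (fun i => autz (f i) (x i)) a (iota 0 N).

Lemma prod_autS N x a : prod_aut N.+1 x a = prod_aut N x (autz (f N) (x N) a).
Proof. by rewrite /prod_aut -addn1 iotaD foldr_cat. Qed.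

Lemma prod_aut_width N x a : (width x <= N)%N ->
  prod_aut N x a = prod_aut (width x) x a.
Proof.
elim: N a => [|N IHN] a; first by rewrite leqn0 => /eqP->.
rewrite leq_eqVlt => /orP[/eqP->//|]; rewrite ltnS => xN.
by rewrite prod_autS IHN // widthP.
Qed.

Lemma prod_aut_zmod N x : zmod_morphism (prod_aut N x).
Proof. by elim: N => // N IHN a b; rewrite !prod_autS autz_zmod IHN. Qed.

Lemma prod_aut_monoid N x : monoid_morphism (prod_aut N x).
Proof.
elim: N => // N [IH1 IHM]; split; first by rewrite prod_autS (autz_monoid _ _).1.
by move=> a b; rewrite !prod_autS (autz_monoid _ _).2 IHM.
Qed.

Definition Phi_fun x := prod_aut (width x) x.

HB.instance Definition _ x :=
  GRing.isZmodMorphism.Build K K (Phi_fun x) (@prod_aut_zmod _ x).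
HB.instance Definition _ x :=
  GRing.isMonoidMorphism.Build K K (Phi_fun x) (@prod_aut_monoid _ x).

Definition Phi_hom x : {rmorphism K -> K} := Phi_fun x.

Hypothesis f_comm : forall i j a, f i (f j a) = f j (f i a).

Lemma prod_aut_comm N x i a : prod_aut N x (f i a) = f i (prod_aut N x a).
Proof.
elim: N a => // N IHN a; rewrite !prod_autS -IHN; congr (prod_aut _ _ _).
by apply/esym/autz_comm => b; exact: f_comm.
Qed.

Lemma prod_autD N x y a :
  prod_aut N (x + y) a = prod_aut N x (prod_aut N y a).
Proof.
elim: N a => // N IHN a; rewrite !prod_autS IHN expoD autzD; congr (prod_aut _ _ _).
by apply: autz_comm => b; exact: prod_aut_comm.
Qed.

Lemma Phi_hom0 a : Phi_hom 0 a = a.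
Proof.
rewrite /Phi_hom /= /Phi_fun; elim: (width 0) a => // N IHN a.
by rewrite prod_autS IHN.
Qed.

Lemma Phi_homD x y a : Phi_hom (x + y) a = Phi_hom x (Phi_hom y a).
Proof.
rewrite /Phi_hom /= /Phi_fun.
pose N := maxn (width (x + y)) (maxn (width x) (width y)).
rewrite -(@prod_aut_width N (x + y)) ?leq_maxl //.
rewrite -(@prod_aut_width N x) -?(@prod_aut_width N y) ?prod_autD //.
- by rewrite /N maxnA leq_maxr.
- by rewrite /N maxnCA leq_maxl.
Qed.

Definition Phi : twist K := Twist Phi_hom0 Phi_homD.

End GaloisTwist.

Section Construction.
Variables (R : realType) (p : nat -> nat).

(* Q(sqrt p_0, sqrt p_1, ...): a subfield of R contains Q automatically. *)
Definition sqrt_pred : {pred R} :=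
  fun x => x \in divgen (range (fun i => Num.sqrt (p i)%:R)).

Lemma sqrt_pred_closed : GRing.divring_closed sqrt_pred.
Proof. exact: divgen_closed. Qed.

HB.instance Definition _ := GRing.isDivringClosed.Build R sqrt_pred sqrt_pred_closed.

Record sqrt_field := SqrtField {
  sqrt_val :> R; sqrt_valP : sqrt_val \in sqrt_pred }.

HB.instance Definition _ := [isSub for sqrt_val].
HB.instance Definition _ := [Choice of sqrt_field by <:].
HB.instance Definition _ := [SubChoice_isSubComUnitRing of sqrt_field by <:].
HB.instance Definition _ := [SubComUnitRing_isSubIntegralDomain of sqrt_field by <:].
HB.instance Definition _ := [SubIntegralDomain_isSubField of sqrt_field by <:].

Lemma sqrt_gen_mem i : Num.sqrt (p i)%:R \in sqrt_pred.
Proof. by rewrite /sqrt_pred unfold_in inE; apply: divgen_sub; exists i. Qed.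

Definition sqrt_gen i : sqrt_field := SqrtField (sqrt_gen_mem i).

(* Since automorphisms of a field of characteristic 0 fix Q, this determines   *)
(* each f i uniquely (see sqrt_field_ext).                                     *)
Definition sqrt_conj (f : nat -> aut sqrt_field) :=
  forall i j, f i (sqrt_gen j) = if j == i then - sqrt_gen j else sqrt_gen j.

Lemma sqrt_field_ext (g h : {rmorphism sqrt_field -> sqrt_field}) :
  (forall i, g (sqrt_gen i) = h (sqrt_gen i)) -> g =1 h.
Proof.
move=> gh x; pose A := [set r : R | exists y : sqrt_field, \val y = r /\ g y = h y].
suff : A (\val x) by case=> y [/val_inj->].
have : \val x \in sqrt_pred by exact: (valP x).
rewrite /sqrt_pred unfold_in inE; apply: divgen_min.
  split; first by rewrite inE; exists 1; rewrite !rmorph1.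
  - move=> _ _ /set_mem[y [<- ghy]] /set_mem[z [<- ghz]].
    by rewrite inE; exists (y - z); rewrite !rmorphB ghy ghz.
  - move=> _ _ /set_mem[y [<- ghy]] /set_mem[z [<- ghz]].
    by rewrite inE; exists (y / z); rewrite !fmorph_div ghy ghz.
by move=> _ [i _ <-]; exists (sqrt_gen i).
Qed.

Variables (f : nat -> aut sqrt_field) (fP : sqrt_conj f).

Lemma sqrt_conj_comm i j a : f i (f j a) = f j (f i a).
Proof.
apply: (@sqrt_field_ext (f i \o f j) (f j \o f i)) => k /=.
by rewrite !fP; do 2!case: ifP => //; rewrite ?rmorphN /= !fP => -> ->.
Qed.

(* The Mal'cev-Neumann division ring K((G, Phi)). *)
Definition MN := series (Phi sqrt_conj_comm).

HB.instance Definition _ := DivRing.on MN.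

(* Q((H)), with H the subgroup of squares x^2, i.e. x + x additively. *)
Definition baseF : set MN :=
  [set a | forall x, a x != 0 -> (exists y, x = y + y) /\ exists q : rat, a x = ratr q].

Definition embK (k : sqrt_field) : MN := monomial _ k 0.
Definition embG (x : expo) : MN := monomial _ 1 x.

Definition Lgens n : set MN :=
  [set a | exists i, (i < n)%N /\ (a = embK (sqrt_gen i) \/ a = embG (gen i))].

Definition L n : set MN := divgen (baseF `|` Lgens n).

Definition Linf : set MN := \bigcup_(n in [set n | (0 < n)%N]) L n.

Lemma L_le n m : (n <= m)%N -> L n `<=` L m.
Proof.
move=> nm; apply: divgen_le => a [Fa|[i [ni ai]]]; first by left.
by right; exists i; split=> //; apply: leq_trans nm.
Qed.

Definition Linf_pred : {pred MN} := fun a => a \in Linf.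

Lemma Linf_closed : GRing.divring_closed Linf_pred.
Proof.
have cl n := divgen_closed (baseF `|` Lgens n).
have bin x y : x \in Linf_pred -> y \in Linf_pred ->
    exists n, (0 < n)%N /\ (x \in L n /\ y \in L n).
  move=> /set_mem[n /= n0 nx] /set_mem[m /= m0 my]; exists (maxn n m).
  rewrite !inE leq_max n0; split=> //.
  by split; [apply: L_le nx; exact: leq_maxl|apply: L_le my; exact: leq_maxr].
split.
- by apply/mem_set; exists 1%N => //; have [/set_mem] := cl 1%N.
- move=> x y xL yL; have [n [n0 [xn yn]]] := bin x y xL yL.
  by apply/mem_set; exists n => //; have [_ clB _] := cl n; exact: set_mem (clB _ _ xn yn).
- move=> x y xL yL; have [n [n0 [xn yn]]] := bin x y xL yL.
  by apply/mem_set; exists n => //; have [_ _ clV] := cl n; exact: set_mem (clV _ _ xn yn).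
Qed.

HB.instance Definition _ := GRing.isDivringClosed.Build MN Linf_pred Linf_closed.

Record Linfty := MkLinfty { Linfty_val :> MN; Linfty_valP : Linfty_val \in Linf_pred }.

HB.instance Definition _ := [isSub for Linfty_val].
HB.instance Definition _ := [Choice of Linfty by <:].
HB.instance Definition _ := [SubChoice_isSubUnitRing of Linfty by <:].

Lemma Linfty_unit (a : Linfty) : a != 0 -> a \is a GRing.unit.
Proof. by []. Qed.

HB.instance Definition _ := UnitRing_isDivRing.Build Linfty Linfty_unit.

End Construction.

(* Main.v *)
(* Write s_i for sqrt p_i. Elements of F are central and s_i, x_i commute up to  *)
(* sign with central squares, so the first 2n of them generate over the center a *)
(* finite-dimensional subring; every element of such a subring is algebraic, so  *)
(* it is a division ring, and these subrings exhaust L_infty. The subfield       *)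
(* generated by the s_i is its own centralizer: conjugating by s_n kills the     *)
(* terms involving x_n. In a centrally finite overring the centralizers of       *)
(* {x_i | i >= n} would increase strictly forever, since s_n commutes with all   *)
(* x_i, i > n, but anticommutes with x_n.                                        *)

Require Import Defs.
From mathcomp Require Import all_boot all_order all_algebra finmap.
From mathcomp Require Import boolp classical_sets functions cardinality reals.

Set Implicit Arguments.
Unset Strict Implicit.
Unset Printing Implicit Defensive.

Import Order.TTheory GRing.Theory Num.Theory.

Local Open Scope classical_set_scope.
Local Open Scope ring_scope.

(** The argument uses only sign relations: all the s_i and x_j commute with one another, except that
    x_i s_i = - s_i x_i, and their squares are central. The section [Tower] works in any division
    ring with 2 nonzero that such elements exhaust over its center.

    Adjoining s_0, x_0, s_1, x_1, ... to the center gives rings [tower n] spanned by finitely many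
    products. An ascending chain of subspaces of a finitely spanned space must stop ([zspan_chain]).
    Applied to polynomials in one element, this gives algebraicity, so each [tower n] is closed
    under inversion ([zalgebra_divsubring]) and the towers exhaust the ring. This yields local
    finiteness. For strong algebraicity, [tower_centralizer] shows that the subfield generated by
    the s_i contains everything commuting with it, and an element of [tower n] can fail to commute
    only with s_i for i < n. Applied to centralizers of the tails of (x_i) inside a centrally finite
    overring, the same chain lemma rules out linearity. *)

Section Divsubring.
Variable E : unitRingType.
Implicit Types (A S : set E) (x y : E).

Lemma divsubring_intro A : A 1 -> (forall x y, A x -> A y -> A (x - y)) ->
    (forall x y, A x -> A y -> A (x * y)) -> (forall x, A x -> A x^-1) ->
  divsubring A.
Proof.
move=> A1 AB AM AV; split; first by rewrite inE.
- by move=> x y; rewrite !inE; exact: AB.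
- by move=> x y; rewrite !inE => Ax /AV; exact: AM.
Qed.

Variable A : set E.
Hypothesis clA : divsubring A.

Lemma divsubring1 : A 1.
Proof. by have [/set_mem] := clA. Qed.

Lemma divsubringB x y : A x -> A y -> A (x - y).
Proof. by have [_ AB _] := clA => Ax Ay; apply/set_mem/AB; exact/mem_set. Qed.

Lemma divsubring_div x y : A x -> A y -> A (x / y).
Proof. by have [_ _ AV] := clA => Ax Ay; apply/set_mem/AV; exact/mem_set. Qed.

Lemma divsubringV x : A x -> A x^-1.
Proof. by rewrite -div1r; exact: divsubring_div divsubring1. Qed.

Lemma divsubringM x y : A x -> A y -> A (x * y).
Proof. by rewrite -[y in x * y]invrK => Ax /divsubringV; exact: divsubring_div. Qed.

End Divsubring.

(** * Linear algebra and finitely spanned algebras over the center *)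

Section CenterSpaces.
Variable E : divRingType.
Implicit Types (A V W : set E) (b : seq E) (c x y z t : E).
Local Notation Z := (@center E).

Lemma center_closed : divsubring Z.
Proof.
apply: divsubring_intro => [x|x y Zx Zy z|x y Zx Zy z|x Zx z].
- by rewrite mul1r mulr1.
- by rewrite mulrBl mulrBr Zx Zy.
- by rewrite -mulrA Zy mulrA Zx mulrA.
- by apply/esym/commrV; exact/esym/Zx.
Qed.

Lemma center0 : Z 0. Proof. by move=> x; rewrite mul0r mulr0. Qed.
Lemma center1 : Z 1. Proof. exact: divsubring1 center_closed. Qed.
Lemma centerN c : Z c -> Z (- c).
Proof. by move=> Zc; rewrite -sub0r; exact: (divsubringB center_closed center0 Zc). Qed.
Lemma centerM x y : Z x -> Z y -> Z (x * y).
Proof. exact: (divsubringM center_closed). Qed.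
Lemma centerV x : Z x -> Z x^-1.
Proof. exact: (divsubringV center_closed). Qed.

Definition zsubspace V := [/\ V 0, forall x y, V x -> V y -> V (x - y) &
  forall c x, Z c -> V x -> V (c * x)].

(** Recursive form of the span, so that dimension arguments become inductions on the list, without
    bases; [zspanP] links it to the sums in [center_findim]. *)
Fixpoint zspan b : set E :=
  if b is a :: b' then
    [set x | exists c y, [/\ Z c, zspan b' y & x = c * a + y]]
  else [set 0].

Lemma zspanP b x : zspan b x <->
  exists c : nat -> E, (forall i, Z (c i)) /\ x = \sum_(i < size b) c i * b`_i.
Proof.
elim: b x => [|a b IHb] x /=.
  split=> [->|[c [_ ->]]]; last by rewrite big_ord0.
  by exists (fun=> 0); rewrite big_ord0; split=> // i; exact: center0.
split=> [[c [y [Zc /IHb[d [Zd ->]] ->]]]|[c [Zc ->]]].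
  by exists (fun i => if i is j.+1 then d j else c); rewrite big_ord_recl; split=> // -[].
rewrite big_ord_recl; exists (c 0%N), (\sum_(i < size b) c i.+1 * b`_i).
by split=> //; apply/IHb; exists (c \o succn); split=> // i; exact: Zc.
Qed.

Lemma zspan_subspace b : zsubspace (zspan b).
Proof.
elim: b => [|a b [b0 bB bZ]] /=.
  by split=> [|_ _ -> ->|c _ _ ->] //=; rewrite ?subrr ?mulr0.
split.
- by exists 0, 0; split=> //; rewrite ?mul0r ?addr0 //; exact: center0.
- move=> _ _ [c [y [Zc by0 ->]]] [d [z [Zd bz ->]]]; exists (c - d), (y - z).
  split; [exact: (divsubringB center_closed Zc Zd)|exact: bB|].
  by rewrite mulrBl opprD addrACA.
- move=> c _ Zc [d [y [Zd by0 ->]]]; exists (c * d), (c * y).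
  by split; [exact: centerM|exact: bZ|rewrite mulrDr mulrA].
Qed.

Lemma zsubspaceD V x y : zsubspace V -> V x -> V y -> V (x + y).
Proof.
by move=> [V0 VB _] Vx Vy; rewrite -[y]opprK -[- y]sub0r; apply: VB (VB _ _ V0 Vy).
Qed.

Lemma zspan_cat b b' x y : zspan b x -> zspan b' y -> zspan (b ++ b') (x + y).
Proof.
elim: b x => [|a b IHb] x /=; first by move=> ->; rewrite add0r.
move=> [c [z [Zc bz ->]]] b'y.
by exists c, (z + y); rewrite addrA; split=> //; exact: IHb.
Qed.

Lemma zspan_mulr b x t : zspan b x -> zspan [seq a * t | a <- b] (x * t).
Proof.
elim: b x => [|a b IHb] x /=; first by move=> ->; rewrite mul0r.
move=> [c [y [Zc by0 ->]]].
by exists c, (y * t); rewrite mulrDl mulrA; split=> //; exact: IHb.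
Qed.

Lemma zsubspaceI V W : zsubspace V -> zsubspace W -> zsubspace (V `&` W).
Proof.
move=> [V0 VB VZ] [W0 WB WZ]; split=> [|x y [Vx Wx] [Vy Wy]|c x Zc [Vx Wx]].
- by [].
- by split; [exact: VB|exact: WB].
- by split; [exact: VZ|exact: WZ].
Qed.

(** The span of [b] has codimension at most one in that of [a :: b], so any [w] outside it can
    replace [a]. *)
Lemma zspan_pivot a b w x : zspan (a :: b) w -> ~ zspan b w -> zspan (a :: b) x ->
  exists c, Z c /\ zspan b (x - c * w).
Proof.
have [b0 bB bZ] := zspan_subspace b.
move=> [c [y [Zc by0 ->]]] bw [d [z [Zd bz ->]]].
have c0 : c != 0 by apply: contra_notN bw => /eqP->; rewrite mul0r add0r.
have Zdc : Z (d / c) by apply: centerM => //; exact: centerV.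
(* With w = c a + y and x = d a + z, this factor cancels the multiples of [a]. *)
exists (d / c); split=> //.
rewrite mulrDr mulrA divrK ?neq0_unit // opprD addrACA subrr add0r.
by apply: bB => //; exact: bZ.
Qed.

(** The noetherian property, in the form of one step at which the chain does not grow. If some
    member leaves the span of [b], a pivot in it reduces the later members to their intersections
    with that span. *)
Lemma zspan_chain b (W : nat -> set E) :
    (forall n, zsubspace (W n)) -> (forall n, W n `<=` W n.+1) ->
    (forall n, W n `<=` zspan b) ->
  exists n, W n.+1 `<=` W n.
Proof.
elim: b W => [|a b IHb] W subW incW bW.
  by exists 0%N => x /bW ->; have [] := subW 0%N.
have [[m [w [Wmw bw]]]|nW] := pselect (exists m w, W m w /\ ~ zspan b w); last first.
  apply: IHb => // n x Wx; apply: contrapT => bx; apply: nW.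
  by exists n, x.
have Ww n : W (n + m)%N w.
  by elim: n => // n; exact: incW.
(* The chain is shifted by [m] so that the pivot [w] lies in every member. *)
have [|n x [Wx bx]|n x []//|n Wn] := IHb (fun n => W (n + m)%N `&` zspan b).
- by move=> n; apply: zsubspaceI (subW _) (zspan_subspace b).
- by split=> //; exact: incW.
exists (n + m)%N => x Wx; have [c [Zc bx]] := zspan_pivot (bW _ _ Wmw) bw (bW _ _ Wx).
have [_ WB WZ] := subW (n + m).+1; rewrite -(subrK (c * w) x).
apply: zsubspaceD (subW _) _ _; last by have [_ _] := subW (n + m)%N; apply.
have [|//] := Wn (x - c * w); split=> //; apply: WB => //.
by apply: WZ => //; exact: (Ww n.+1).
Qed.

(** [center_findim] asks for a spanning family inside [V], whereas [b] need not lie in [V]. One is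
    collected by taking a pivot of [V], when there is one, at each entry of [b]. *)
Lemma findim_sub b V : zsubspace V -> V `<=` zspan b -> center_findim V.
Proof.
suff H : zsubspace V -> V `<=` zspan b ->
    exists b', (forall x, x \in b' -> V x) /\ V `<=` zspan b'.
  move=> subV /(H subV)[b' [Vb' b'V]]; exists b'; split=> // x /b'V.
  by move/zspanP.
elim: b V => [|a b IHb] V subV bV; first by exists [::].
have [b' [Vb' b'V]] := IHb _ (zsubspaceI subV (zspan_subspace b)) (@subIsetr _ _ _).
have [[w [Vw bw]]|nV] := pselect (exists w, V w /\ ~ zspan b w); last first.
  exists b'; split=> [x /Vb'[]//|x Vx]; apply: b'V; split=> //.
  by apply: contrapT => bx; apply: nV; exists x.
exists (w :: b'); split=> [x|x Vx].
  by rewrite inE => /orP[/eqP->//|/Vb'[]].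
have [c [Zc bx]] := zspan_pivot (bV _ Vw) bw (bV _ Vx).
exists c, (x - c * w); rewrite [c * w + _]addrC subrK; split=> //; apply: b'V; split=> //.
by have [_ VB VZ] := subV; apply: VB => //; exact: VZ.
Qed.

(** Inverses are left out on purpose: they come for free in the finitely spanned case, by
    [zalgebra_divsubring]. *)
Definition zalgebra A := [/\ Z `<=` A, forall x y, A x -> A y -> A (x - y) &
  forall x y, A x -> A y -> A (x * y)].

Lemma zalgebra_subspace A : zalgebra A -> zsubspace A.
Proof.
by move=> [ZA AB AM]; split=> // [|c x /ZA]; [exact/ZA/center0|exact: AM].
Qed.

Lemma zalgebraD A x y : zalgebra A -> A x -> A y -> A (x + y).
Proof. by move/zalgebra_subspace; exact: zsubspaceD. Qed.

Lemma center_zalgebra : zalgebra Z.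
Proof.
split=> // x y Zx Zy; last exact: centerM.
exact: (divsubringB center_closed Zx Zy).
Qed.

Lemma center_gen_zalgebra S : zalgebra (center_gen S).
Proof.
have clS := divgen_closed (Z `|` S); split=> [x Zx|x y|x y].
- by apply: divgen_sub; left.
- exact: divsubringB.
- exact: divsubringM.
Qed.

Lemma zalgebra_horner A x (q : {poly E}) : zalgebra A -> A x ->
  (forall i, Z q`_i) -> A q.[x].
Proof.
move=> zA Ax; have [ZA AB AM] := zA; elim/poly_ind: q => [|q c IHq] Zq.
  by rewrite horner0; apply/ZA/center0.
rewrite hornerMXaddC; apply: zalgebraD => //.
  apply: AM => //; apply: IHq => i; have := Zq i.+1.
  by rewrite coefD coefMX coefC /= addr0.
by apply: ZA; have := Zq 0%N; rewrite coefD coefMX coefC /= add0r.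
Qed.

(** The values at [x] of central polynomials of size at most n form a chain in a finitely spanned
    space. Where it stops, x^n is a combination of lower powers. *)
Lemma zalgebra_algebraic A b x : zalgebra A -> A `<=` zspan b -> A x ->
  center_algebraic x.
Proof.
move=> zA Ab Ax.
pose W n := [set q.[x] | q in [set q : {poly E} |
  (forall i, Z q`_i) /\ (size q <= n)%N]].
have [||n y|n Wn] := @zspan_chain b W.
- move=> n; split.
  + exists 0; rewrite ?horner0 //; split=> [i|]; last by rewrite size_poly0.
    by rewrite coef0; exact: center0.
  + move=> _ _ [q [Zq qn] <-] [r [Zr rn] <-]; exists (q - r); rewrite ?hornerD ?hornerN //.
    split=> [i|]; first by rewrite coefB; exact: (divsubringB center_closed (Zq i) (Zr i)).
    by apply: leq_trans (size_polyD _ _) _; rewrite size_polyN geq_max qn rn.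
  + move=> c _ Zc [q [Zq qn] <-]; exists (c%:P * q); last by rewrite hornerCM.
    split=> [i|]; first by rewrite coefCM; apply: centerM.
    by apply: leq_trans qn; rewrite mul_polyC size_scale_leq.
- by move=> n y [q [Zq qn] <-]; exists q => //; split=> //; exact: leqW.
- by move=> [q [Zq _] <-]; apply: Ab; apply: zalgebra_horner.
have ZX i : Z ('X^n)`_i.
  by rewrite coefXn; case: eqP => _; [exact: center1|exact: center0].
(* ['X^n] has size n + 1, so x^n lies in the member that brings nothing new. *)
have [|q [Zq qn] qx] := Wn (x ^+ n).
  by exists 'X^n; rewrite ?hornerXn //; split=> //; rewrite size_polyXn.
exists ('X^n - q); split.
- apply: contraTneq qn => /eqP; rewrite subr_eq0 => /eqP <-.
  by rewrite size_polyXn ltnn.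
- move=> i; rewrite coefB; exact: (divsubringB center_closed (ZX i) (Zq i)).
- by rewrite /root hornerD hornerN hornerXn qx subrr.
Qed.

(** Cancel powers of [x] from the relation until its constant term c is nonzero; then q(x) x + c = 0
    gives the inverse as - c^-1 q(x). *)
Lemma zalgebra_inv A x : zalgebra A -> A x -> center_algebraic x -> A x^-1.
Proof.
move=> zA Ax [q [q0 Zq /eqP qx]]; have [ZA AB AM] := zA.
have [->|x0] := eqVneq x 0; first by rewrite invr0; apply/ZA/center0.
elim/poly_ind: q q0 Zq qx => [|q c IHq]; first by rewrite eqxx.
move=> qc0 Zqc; rewrite hornerMXaddC => qx.
have Zq i : Z q`_i.
  by have := Zqc i.+1; rewrite coefD coefMX coefC /= addr0.
have Zc : Z c by have := Zqc 0%N; rewrite coefD coefMX coefC /= add0r.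
have [c0|c0] := eqVneq c 0.
  rewrite c0 polyC0 addr0 in qc0; apply: IHq => //.
    by apply: contraNneq qc0 => ->; rewrite mul0r.
  by rewrite c0 addr0 in qx; apply: (mulIr (neq0_unit _ x0)); rewrite mul0r.
have -> : x^-1 = - c^-1 * q.[x].
  apply: (mulIr (neq0_unit _ x0)); rewrite mulVr ?neq0_unit // -mulrA.
  by rewrite -[q.[x] * x](addrK c) qx sub0r mulrNN mulVr ?neq0_unit.
by apply: AM; [apply/ZA/centerN/centerV|exact: zalgebra_horner].
Qed.

Lemma zalgebra_divsubring A b : zalgebra A -> A `<=` zspan b -> divsubring A.
Proof.
move=> zA Ab; have [ZA AB AM] := zA; apply: divsubring_intro => //.
  exact/ZA/center1.
by move=> x Ax; apply: zalgebra_inv => //; exact: zalgebra_algebraic Ab Ax.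
Qed.

Definition adjoin A t := [set x | exists c d, [/\ A c, A d & x = c + d * t]].

Lemma adjoin_sub A t : zalgebra A -> A `<=` adjoin A t.
Proof.
move=> [ZA _ _] a Aa; exists a, 0; rewrite mul0r addr0; split=> //.
exact/ZA/center0.
Qed.

Lemma adjoin_gen A t : zalgebra A -> adjoin A t t.
Proof.
move=> [ZA _ _]; exists 0, 1; rewrite mul1r add0r.
by split=> //; apply: ZA; [exact: center0|exact: center1].
Qed.

(** Since t A lies in A t and t^2 in A, every product of two elements of A + A t can be rewritten
    with [t] on the right and to degree at most one. *)
Lemma adjoin_zalgebra A t : zalgebra A -> A (t * t) ->
    (forall a, A a -> exists2 a', A a' & t * a = a' * t) ->
  zalgebra (adjoin A t).
Proof.
move=> zA Att tA; have [ZA AB AM] := zA; split.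
- by move=> x /ZA; exact: adjoin_sub.
- move=> _ _ [a [b [Aa Ab ->]]] [c [d [Ac Ad ->]]]; exists (a - c), (b - d).
  by rewrite mulrBl opprD addrACA; split=> //; exact: AB.
- move=> _ _ [a [b [Aa Ab ->]]] [c [d [Ac Ad ->]]].
  have [c' Ac' tc] := tA _ Ac; have [d' Ad' td] := tA _ Ad.
  exists (a * c + b * d' * (t * t)), (a * d + b * c').
  split.
  + by apply: (zalgebraD zA); apply: (AM) => //; exact: AM.
  + by apply: (zalgebraD zA); exact: AM.
  have e1 : b * t * c = b * c' * t by rewrite -mulrA tc mulrA.
  have e2 : b * t * (d * t) = b * d' * (t * t).
    by rewrite -[LHS]mulrA [t * (d * t)]mulrA td -!mulrA.
  rewrite !mulrDl !mulrDr e1 e2 mulrA -!addrA; congr (_ + _).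
  by rewrite [RHS]addrC -addrA.
Qed.

Lemma adjoin_span A b t : A `<=` zspan b ->
  adjoin A t `<=` zspan (b ++ [seq a * t | a <- b]).
Proof.
by move=> bA _ [c [d [/bA bc /bA bd ->]]]; apply: zspan_cat => //; exact: zspan_mulr.
Qed.

End CenterSpaces.

(** * Centralizers and commuting generators *)

Section Centralizer.
Variable E : divRingType.
Implicit Types (S A : set E) (x y : E).

Definition centralizer S : set E := [set y | forall x, S x -> GRing.comm x y].

Lemma centralizer_closed S : divsubring (centralizer S).
Proof.
apply: divsubring_intro => [x _|x y Cx Cy z Sz|x y Cx Cy z Sz|x Cx z Sz].
- exact: commr1.
- by apply: commrB; [exact: Cx|exact: Cy].
- by apply: commrM; [exact: Cx|exact: Cy].
- by apply: commrV; exact: Cx.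
Qed.

Lemma centralizer_subspace S : zsubspace (centralizer S).
Proof.
split=> [x _|x y|c x Zc Cx z Sz]; first exact: commr0.
  exact: (divsubringB (centralizer_closed S)).
by apply: commrM; [exact/esym/Zc|exact: Cx].
Qed.

(** Centralizers are division subrings, so commutation passes from generators to the generated ring,
    first in one argument and then in the other. *)
Lemma center_gen_subfield S : (forall x y, S x -> S y -> GRing.comm x y) ->
  subfield (center_gen S).
Proof.
move=> Scomm; split; first exact: divgen_closed.
have SM : S `<=` centralizer (center_gen S).
  move=> y Sy z Mz; suff : centralizer S z by move=> /(_ y Sy) /esym.
  apply: (divgen_min (centralizer_closed S) _ Mz) => x [Zx|Sx] t St.
    exact/esym/Zx.
  exact: Scomm.
move=> x y Mx My.
apply: (divgen_min (centralizer_closed (center_gen S)) _ My) Mx => z [Zz|/SM//] t _.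
exact/esym/Zz.
Qed.

End Centralizer.

(** * Independence from anticommutation *)

Section SignCommuting.
Variable E : divRingType.
Implicit Types a b g t : E.

Lemma double_eq0 a : (2 : E) != 0 -> a + a = 0 -> a = 0.
Proof.
move=> two0 aa; apply: (mulrI (neq0_unit _ two0)).
by rewrite mulr0 mulr_natl mulr2n.
Qed.

(* Conjugating the relation a + b t = 0 by g gives a - b t = 0. *)
Lemma anticomm_indep g t a b : (2 : E) != 0 -> g != 0 -> t != 0 ->
  g * t = - (t * g) -> GRing.comm g a -> GRing.comm g b -> a + b * t = 0 ->
  a = 0 /\ b = 0.
Proof.
move=> two0 g0 t0 gt ga gb abt.
have abt' : a - b * t = 0.
  apply: (mulIr (neq0_unit _ g0)); rewrite mul0r mulrBl -ga -mulrA.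
  by rewrite -[t * g]opprK -gt mulrN opprK mulrA -gb -mulrA -mulrDr abt mulr0.
have a0 : a = 0.
  apply: double_eq0 => //; rewrite -[RHS]addr0 -{1}abt -abt'.
  by rewrite addrACA subrr addr0.
split=> //; apply: (mulIr (neq0_unit _ t0)).
by rewrite mul0r -abt a0 add0r.
Qed.

End SignCommuting.

(** * The tower of finitely spanned algebras, and the three properties in abstract form *)

Section Tower.
Variables (E : divRingType) (s x : nat -> E).
Local Notation Z := (@center E).

Definition tower_gens n : set E :=
  [set a | exists i, (i < n)%N /\ (a = s i \/ a = x i)].

Hypothesis two_neq0 : (2 : E) != 0.
Hypotheses (s_neq0 : forall i, s i != 0) (x_neq0 : forall i, x i != 0).
Hypotheses (s_comm : forall i j, GRing.comm (s i) (s j))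
  (x_comm : forall i j, GRing.comm (x i) (x j))
  (xs_comm : forall i j, i != j -> GRing.comm (x i) (s j))
  (xs_anti : forall i, x i * s i = - (s i * x i)).
Hypotheses (s_sqr : forall i, Z (s i * s i)) (x_sqr : forall i, Z (x i * x i)).
Hypothesis gens_exhaust : forall y, exists n, center_gen (tower_gens n) y.

(** Adjoining x_m last writes each element as u + v x_m with u and v in A + A s_m, the form that
    [tower_centralizer] starts from. *)
Fixpoint tower n : set E :=
  if n is m.+1 then adjoin (adjoin (tower m) (s m)) (x m) else Z.

Lemma tower_comm n i y : (n <= i)%N -> tower n y ->
  GRing.comm (s i) y /\ GRing.comm (x i) y.
Proof.
elim: n i y => [|n IHn] i y ni; first by move=> Zy; split; exact/esym/Zy.
move=> [_ [_ [[a [b [Aa Ab ->]]] [c [d [Ac Ad ->]]] ->]]].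
have ni' := ltnW ni; have neq_in : i != n by rewrite gtn_eqF.
have [sa xa] := IHn _ _ ni' Aa; have [sb xb] := IHn _ _ ni' Ab.
have [sc xc] := IHn _ _ ni' Ac; have [sd xd] := IHn _ _ ni' Ad.
have sx : GRing.comm (s i) (x n) by apply/esym/xs_comm; rewrite eq_sym.
have xs := xs_comm neq_in.
by split; (apply: commrD; [|apply: commrM => //]); apply: commrD => //; exact: commrM.
Qed.

Lemma tower_zalgebra n : zalgebra (tower n) /\ zalgebra (adjoin (tower n) (s n)).
Proof.
have step m : zalgebra (tower m) -> zalgebra (adjoin (tower m) (s m)).
  move=> zA; have [ZA _ _] := zA; apply: adjoin_zalgebra => //; first exact: ZA.
  by move=> a Aa; have [sa _] := tower_comm (leqnn m) Aa; exists a.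
suff zA : zalgebra (tower n) by split=> //; exact: step.
elim: n => [|n IHn]; first exact: center_zalgebra.
have zB := step _ IHn; have [ZB _ _] := zB; apply: adjoin_zalgebra => //; first exact: ZB.
(* Moving x_n across a + b s_n flips the sign of s_n and leaves the lower level alone. *)
move=> _ [a [b [Aa Ab ->]]]; exists (a + (- b) * s n).
  have [A0 AB _] := zalgebra_subspace IHn.
  by exists a, (- b); split=> //; rewrite -sub0r; exact: AB.
have [_ xa] := tower_comm (leqnn n) Aa; have [_ xb] := tower_comm (leqnn n) Ab.
by rewrite mulrDr mulrDl xa mulrA xb -mulrA xs_anti mulrN mulNr mulrA mulNr.
Qed.

Lemma tower_span n : exists b, tower n `<=` zspan b.
Proof.
elim: n => [|n [b nb]].
  exists [:: 1] => z Zz; exists z, 0; rewrite mulr1 addr0; split=> //.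
by eexists; apply: adjoin_span; apply: adjoin_span; exact: nb.
Qed.

Lemma tower_mono m n : (m <= n)%N -> tower m `<=` tower n.
Proof.
elim: n => [|n IHn]; first by rewrite leqn0 => /eqP->.
rewrite leq_eqVlt => /orP[/eqP->//|/IHn mn] y /mn ny.
have [zA zB] := tower_zalgebra n.
by apply: adjoin_sub => //; exact: adjoin_sub.
Qed.

Lemma tower_gen n y : tower_gens n y -> tower n y.
Proof.
move=> [i [ni iy]]; apply: (tower_mono ni) => /=.
have [zA zB] := tower_zalgebra i.
by case: iy => ->; [apply: adjoin_sub => //; exact: adjoin_gen|exact: adjoin_gen].
Qed.

(** Being finitely spanned, [tower n] is a division subring, so it contains all that its generators
    generate. *)
Lemma tower_exhaust y : exists n, tower n y.
Proof.
have [n ny] := gens_exhaust y; exists n; move: ny.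
have [b nb] := tower_span n; have [zA _] := tower_zalgebra n.
apply: divgen_min; first exact: zalgebra_divsubring nb.
by move=> z [Zz|]; [case: zA => ZA _ _; exact: ZA|exact: tower_gen].
Qed.

Lemma tower_locally_finite : locally_centrally_finite E.
Proof.
move=> S /finite_seqP[l ->].
have [n ln] : exists n, forall y, y \in l -> tower n y.
  elim: l => [|a l [n ln]]; first by exists 0%N.
  have [m ma] := tower_exhaust a; exists (maxn m n) => y.
  rewrite inE => /orP[/eqP->|/ln]; [apply: tower_mono ma|apply: tower_mono].
    exact: leq_maxl.
  exact: leq_maxr.
have [b nb] := tower_span n; have [zA _] := tower_zalgebra n.
apply: (@findim_sub _ b); first exact/zalgebra_subspace/center_gen_zalgebra.
move=> y ly; apply: (nb); move: y ly; apply: divgen_min.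
  exact: zalgebra_divsubring nb.
by move=> z [Zz|/ln//]; case: zA => ZA _ _; exact: ZA.
Qed.

(** Descent on the level: for y = u + v x_n, commuting with s_n forces v = 0, and the two
    coefficients of u in [tower n] again commute with every s_i. *)
Lemma tower_centralizer n y : tower n y -> (forall i, GRing.comm (s i) y) ->
  center_gen (range s) y.
Proof.
have clM := divgen_closed (Z `|` range s).
have [ZM MB MM] := center_gen_zalgebra (range s).
elim: n y => [|n IHn] y; first by move=> /ZM.
move=> [u [v [Bu [c [d [Ac Ad vE]]] ->]]] suv.
have [a [b [Aa Ab uE]]] := Bu.
have [sa xa] := tower_comm (leqnn n) Aa; have [sb xb] := tower_comm (leqnn n) Ab.
have [sc xc] := tower_comm (leqnn n) Ac; have [sd xd] := tower_comm (leqnn n) Ad.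
have su : GRing.comm (s n) u.
  by rewrite uE; apply: commrD => //; exact: commrM.
have sv : GRing.comm (s n) v.
  by rewrite vE; apply: commrD => //; exact: commrM.
(* Both u and v commute with s_n while x_n anticommutes with it, so s_n v x_n equals its own
   opposite. *)
have v0 : v = 0.
  apply: (mulIr (neq0_unit _ (x_neq0 n))); apply: (mulrI (neq0_unit _ (s_neq0 n))).
  rewrite mul0r mulr0; apply: double_eq0 => //.
  have := suv n; rewrite /GRing.comm mulrDr mulrDl -su -mulrA xs_anti => /addrI.
  by move=> sE; rewrite {1}sE mulrN [v * (_ * _)]mulrA -sv -mulrA addNr.
move: suv; rewrite v0 mul0r addr0 => {su Bu} su.
have split_comm i : GRing.comm (s i) a /\ GRing.comm (s i) b.
  have [ni|ilt] := leqP n i.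
    by have [] := tower_comm ni Aa; have [] := tower_comm ni Ab.
  (* For i < n the commutators with s_i satisfy [s_i, a] + [s_i, b] s_n = 0. Both commute with x_n,
     which anticommutes with s_n, so both vanish. *)
  have Asi : tower n (s i) by apply: tower_gen; exists i; split=> //; left.
  have xsi : GRing.comm (x n) (s i) by have [] := tower_comm (leqnn n) Asi.
  have [] := @anticomm_indep _ (x n) (s n) (s i * a - a * s i) (s i * b - b * s i).
  - exact: two_neq0.
  - exact: x_neq0.
  - exact: s_neq0.
  - exact: xs_anti.
  - by apply: commrB; exact: commrM.
  - by apply: commrB; exact: commrM.
  - have := su i; rewrite uE /GRing.comm => /eqP; rewrite -subr_eq0 => /eqP <-.
    rewrite [s i * (a + _)]mulrDr [(a + _) * s i]mulrDl opprD [RHS]addrACA mulrBl -!mulrA.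
    by rewrite [s n * s i]s_comm.
  - by move=> /eqP + /eqP; rewrite !subr_eq0 => /eqP ? /eqP.
have Ms : center_gen (range s) (s n) by apply: divgen_sub; right; exists n.
rewrite uE; apply: (zalgebraD (center_gen_zalgebra _)).
  by apply: IHn => // i; have [] := split_comm i.
by apply: MM => //; apply: IHn => // i; have [] := split_comm i.
Qed.

Lemma tower_strongly_algebraic : strongly_algebraic E.
Proof.
split=> [y|].
  have [n ny] := tower_exhaust y; have [b nb] := tower_span n.
  by have [zA _] := tower_zalgebra n; exact: zalgebra_algebraic nb ny.
have Ms i : center_gen (range s) (s i) by apply: divgen_sub; right; exists i.
exists (center_gen (range s)); split; last first.
  exists (range s); split=> // [_ [i _ <-]//|y].
  have [n ny] := tower_exhaust y.
  apply: sub_finite_set (finite_image s (finite_II n)) => _ [[i _ <-]] ysi.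
  exists i => //=; rewrite ltnNge; apply/negP => /tower_comm /(_ ny)[sy _].
  by apply: ysi; rewrite sy.
split=> [|N [_ Ncomm] MN].
  by apply: center_gen_subfield => _ _ [i _ <-] [j _ <-]; exact: s_comm.
(* A larger subfield commutes with every s_i, hence lies in their centralizer. *)
apply/seteqP; split=> // y Ny; have [n ny] := tower_exhaust y.
by apply: (tower_centralizer ny) => i; apply: Ncomm => //; exact: MN.
Qed.

(** The centralizers of {h(x_i) : i >= n} are subspaces over the center of [T], however that center
    meets the image of [E]. They grow at every n, because h(s_n) enters exactly when h(x_n) is
    dropped. *)
Lemma tower_not_linear : ~ linear_divring E.
Proof.
move=> [T [[b [_ Tb]] [h h_inj]]].
pose W n := centralizer [set h (x i) | i in [set i | (n <= i)%N]].
have [|n y Wy|n y _|n Wn] := @zspan_chain _ b W.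
- by move=> n; exact: centralizer_subspace.
- by move=> _ [i /= ni <-]; apply: Wy; exists i => //=; exact: ltnW.
- by apply/zspanP; exact: Tb.
have Wsn : W n (h (s n)).
  apply: Wn => _ [i /= ni <-]; rewrite /GRing.comm -!rmorphM xs_comm //.
  by rewrite gtn_eqF.
have /h_inj : h (x n * s n) = h (s n * x n).
  by rewrite !rmorphM; apply: Wsn; exists n => /=.
rewrite xs_anti => /eqP; rewrite eq_sym -subr_eq0 opprK => /eqP.
move=> /(double_eq0 two_neq0) sx0; have /eqP := s_neq0 n; apply.
by apply: (mulIr (neq0_unit _ (x_neq0 n))); rewrite mul0r.
Qed.

End Tower.

(** * Monomials and central series *)

Section SeriesMonomials.
Variables (K : fieldType) (Phi : twist K).
Implicit Types (a b : series Phi) (k l : K) (x y z : expo).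

Lemma monomialM k l x y :
  monomial Phi k x * monomial Phi l y = monomial Phi (k * Phi x l) (x + y).
Proof.
apply/seriesP => z; rewrite Defs.coefM -[LHS]/(mul_coef _ _ z).
rewrite (mul_coefE (X := [fset x]%fset)) => [|u /=]; last first.
  by rewrite in_fset1; case: (u == x) => //; rewrite eqxx.
rewrite big_seq_fset1 /= eqxx subr_eq addrC; case: ifP => // _.
by rewrite rmorph0 mulr0.
Qed.

Lemma monomial_eq0 k x : (monomial Phi k x == 0) = (k == 0).
Proof.
apply/eqP/eqP => [/seriesP/(_ x)|->]; first by rewrite /= eqxx.
by apply/seriesP => y /=; case: ifP.
Qed.

Lemma monomialN k x : monomial Phi (- k) x = - monomial Phi k x.
Proof. by apply/seriesP => y; rewrite Defs.coefN /=; case: ifP => //; rewrite oppr0. Qed.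

(** Under these conditions neither product sees the twist, and the substitution x -> z - x exchanges
    the two convolution sums. *)
Lemma series_central a : (forall x k, a x != 0 -> Phi x k = k) ->
  (forall x y, Phi y (a x) = a x) -> forall b, a * b = b * a.
Proof.
move=> aPhi Phia b; apply/seriesP => z.
rewrite !Defs.coefM -[LHS]/(mul_coef _ _ z) -[RHS]/(mul_coef _ _ z).
have [X abX] := mul_fset a b z.
rewrite (mul_coefE abX) (mul_coefE (X := [fset z - x | x in X]%fset)); last first.
  move=> y bY aY; apply/imfsetP; exists (z - y); last by rewrite subKr.
  by apply: abX => //; rewrite subKr.
rewrite big_imfset /=; last by move=> x y _ _ /addrI/oppr_inj.
apply: eq_bigr => x _; rewrite subKr Phia mulrC.
have [->|ax] := eqVneq (a x) 0; first by rewrite !mulr0.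
by rewrite aPhi.
Qed.

End SeriesMonomials.

(** * The twist on squares and on generators *)

Section Twist.
Variable K : fieldType.

Lemma autz_double (s : aut K) n a : (forall b, s (s b) = b) -> autz s (n + n) a = a.
Proof.
move=> ss; have si b : aut_inv s (aut_inv s b) = b by rewrite -{1}[b]ss !aut_funK.
elim/int_rect: n => [|n IHn|n IHn] //.
  by rewrite -addn1 PoszD addrACA addrA !autzS IHn.
by rewrite -addn1 PoszD opprD addrACA addrA !autzP IHn.
Qed.

Variable f : nat -> aut K.
Hypothesis f_comm : forall i j a, f i (f j a) = f j (f i a).

Lemma Phi_double x a : (forall i b, f i (f i b) = b) -> Phi f_comm (x + x) a = a.
Proof.
move=> ff; rewrite /= /Phi_fun; elim: (width _) a => // N IHN a.
by rewrite prod_autS IHN expoD autz_double.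
Qed.

Lemma Phi_gen i a : Phi f_comm (gen i) a = f i a.
Proof.
have prodE N b : prod_aut f N (gen i) b = if (i < N)%N then f i b else b.
  elim: N b => // N IHN b; rewrite prod_autS IHN ltnS /=.
  by have [iN|Ni|->] := ltngtP i N; rewrite ?ltnn ?eqxx.
(* [width] is an unspecified bound, so the product is first lengthened until it surely includes the
   factor [i]. *)
rewrite /= /Phi_fun -(@prod_aut_width _ _ (maxn (width (gen i)) i.+1)) ?leq_maxl //.
by rewrite prodE leq_max leqnn orbT.
Qed.

End Twist.

(** * The sign relations inside L_infty *)

Section Construction.
Variables (R : realType) (p : nat -> nat).
Hypothesis p_prime : forall i, prime (p i).
Variables (f : nat -> aut (sqrt_field R p)) (fP : sqrt_conj f).
Local Notation K := (sqrt_field R p).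
Local Notation D := (MN fP).
Local Notation E := (Linfty fP).

Lemma sqrt_gen_sqr i : sqrt_gen R p i * sqrt_gen R p i = (p i)%:R.
Proof.
apply: val_inj; rewrite rmorph_nat rmorphM /=.
by rewrite -expr2 sqr_sqrtr ?ler0n.
Qed.

Lemma sqrt_gen_neq0 i : sqrt_gen R p i != 0.
Proof.
rewrite -[_ == 0]orbb -mulf_eq0 sqrt_gen_sqr -(inj_eq val_inj) rmorph_nat rmorph0.
by rewrite pnatr_eq0 -lt0n prime_gt0.
Qed.

Lemma sqrt_conj_invol i (a : K) : f i (f i a) = a.
Proof.
apply: (@sqrt_field_ext _ _ (f i \o f i) idfun) => j /=.
by rewrite fP; case: ifP => ji; rewrite ?rmorphN fP ji ?opprK.
Qed.

(** The f_i are involutions, so exponents in H twist trivially, and rational coefficients are fixed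
    by every automorphism. *)
Lemma baseF_central (a : D) : baseF a -> forall b, a * b = b * a.
Proof.
move=> Fa; apply: series_central => [x k /Fa[[y ->] _]|x y].
  by apply: Phi_double; exact: sqrt_conj_invol.
have [->|/Fa[_ [q ->]]] := eqVneq (a x) 0; first exact: rmorph0.
exact: fmorph_rat.
Qed.

Lemma embK_sqr_baseF i : baseF (embK fP (sqrt_gen R p i) * embK fP (sqrt_gen R p i)).
Proof.
rewrite /embK monomialM twist0 sqrt_gen_sqr => x /=.
case: ifP => [/eqP-> _|]; last (by rewrite eqxx); split; first by exists 0.
by exists (p i)%:R; rewrite ratr_nat.
Qed.

Lemma embG_sqr_baseF x : baseF (embG fP x * embG fP x).
Proof.
rewrite /embG monomialM rmorph1 mulr1 => y /=.
case: ifP => [/eqP-> _|]; last (by rewrite eqxx); split; first by exists x.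
by exists 1%:R; rewrite ratr_nat.
Qed.

(** The union [Linf] starts at index 1, hence the passage to [n.+1], which also covers n = 0. *)
Lemma mem_Linf n (a : D) : L n a -> a \in Linf_pred (fP := fP).
Proof. by move=> Lna; apply/mem_set; exists n.+1 => //; apply: L_le Lna. Qed.

Lemma baseF_Linf (a : D) : baseF a -> a \in Linf_pred (fP := fP).
Proof. by move=> Fa; apply: (@mem_Linf 0); apply: divgen_sub; left. Qed.

Lemma embK_Linf i : embK fP (sqrt_gen R p i) \in Linf_pred (fP := fP).
Proof.
apply: (@mem_Linf i.+1); apply: divgen_sub; right.
by exists i; split=> //; left.
Qed.

Lemma embG_Linf i : embG fP (gen i) \in Linf_pred (fP := fP).
Proof.
apply: (@mem_Linf i.+1); apply: divgen_sub; right.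
by exists i; split=> //; right.
Qed.

Definition root_elt i : E := MkLinfty (embK_Linf i).
Definition gen_elt i : E := MkLinfty (embG_Linf i).

Lemma root_elt_neq0 i : root_elt i != 0.
Proof.
by rewrite -(inj_eq val_inj) rmorph0 monomial_eq0 sqrt_gen_neq0.
Qed.

Lemma gen_elt_neq0 i : gen_elt i != 0.
Proof. by rewrite -(inj_eq val_inj) rmorph0 monomial_eq0 oner_eq0. Qed.

Lemma Linfty_two_neq0 : (2 : E) != 0.
Proof.
rewrite -(inj_eq val_inj) rmorph_nat rmorph0; apply/eqP => /seriesP/(_ 0).
rewrite mulr2n Defs.coefD Defs.coef1 eqxx Defs.coef0 => /(congr1 val) /eqP.
by rewrite rmorphD rmorph1 rmorph0 -mulr2n pnatr_eq0.
Qed.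

Lemma Linfty_central (a : E) : baseF (val a) -> center a.
Proof. by move=> Fa b; apply: val_inj; rewrite !rmorphM; exact: baseF_central. Qed.

Lemma root_elt_comm i j : GRing.comm (root_elt i) (root_elt j).
Proof.
apply: val_inj; rewrite !rmorphM /= /embK !monomialM !twist0.
by rewrite mulrC.
Qed.

Lemma gen_elt_comm i j : GRing.comm (gen_elt i) (gen_elt j).
Proof.
apply: val_inj; rewrite !rmorphM /= /embG !monomialM !rmorph1.
by rewrite addrC.
Qed.

Lemma embG_embK i j : embG fP (gen i) * embK fP (sqrt_gen R p j) =
  monomial _ (f i (sqrt_gen R p j)) (gen i).
Proof. by rewrite /embG /embK monomialM addr0 mul1r Phi_gen. Qed.

Lemma embK_embG i j : embK fP (sqrt_gen R p j) * embG fP (gen i) =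
  monomial _ (sqrt_gen R p j) (gen i).
Proof. by rewrite /embG /embK monomialM add0r rmorph1 mulr1. Qed.

Lemma gen_root_comm i j : i != j -> GRing.comm (gen_elt i) (root_elt j).
Proof.
move=> ij; apply: val_inj; rewrite !rmorphM /= embG_embK embK_embG fP.
by rewrite eq_sym (negPf ij).
Qed.

Lemma gen_root_anti i : gen_elt i * root_elt i = - (root_elt i * gen_elt i).
Proof.
apply: val_inj; rewrite rmorphN !rmorphM /= embG_embK embK_embG fP eqxx.
exact: monomialN.
Qed.

(** [L n] is generated inside [D], but [center_gen] inside [E]. The image [B] of the latter in [D]
    is a division subring containing the generators of [L n]. *)
Lemma Linfty_exhaust (y : E) : exists n, center_gen (tower_gens root_elt gen_elt n) y.
Proof.
have [n _ Ly] := set_mem (Linfty_valP y); exists n.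
pose B := [set v : D | exists2 z : E, val z = v &
  center_gen (tower_gens root_elt gen_elt n) z].
suff LB : L n `<=` B by have [z /val_inj->] := LB _ Ly.
have clG := divgen_closed (center (E := E) `|` tower_gens root_elt gen_elt n).
apply: divgen_min.
  apply: divsubring_intro.
  - by exists 1; [rewrite rmorph1|exact: (divsubring1 clG)].
  - move=> _ _ [u <- Gu] [v <- Gv]; exists (u - v); first by rewrite rmorphB.
    exact: (divsubringB clG).
  - move=> _ _ [u <- Gu] [v <- Gv]; exists (u * v); first by rewrite rmorphM.
    exact: (divsubringM clG).
  - move=> _ [u <- Gu]; exists u^-1; last exact: (divsubringV clG).
    (* The inclusion commutes with inversion on units; zero, its own inverse by convention, is
       treated apart. *)
    have [->|u0] := eqVneq u 0; first by rewrite invr0 rmorph0 invr0.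
    by rewrite rmorphV // neq0_unit.
move=> v [Fv|[i [ni iv]]].
  exists (MkLinfty (baseF_Linf Fv)) => //.
  by apply: divgen_sub; left; exact: Linfty_central.
have Ggen z : z = root_elt i \/ z = gen_elt i ->
    center_gen (tower_gens root_elt gen_elt n) z.
  by move=> zi; apply: divgen_sub; right; exists i.
case: iv => ->.
  by exists (root_elt i) => //; apply: Ggen; left.
by exists (gen_elt i) => //; apply: Ggen; right.
Qed.

End Construction.

Theorem proposition2p9 (R : realType) (p : nat -> nat)
    (p_prime : forall i, prime (p i))
    (p_incr : forall i j, (i < j)%N -> (p i < p j)%N)
    (f : nat -> aut (sqrt_field R p)) (fP : sqrt_conj f) :
  [/\ locally_centrally_finite (Linfty fP),
      strongly_algebraic (Linfty fP)
    & ~ linear_divring (Linfty fP)].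
Proof.
have two0 := Linfty_two_neq0 fP.
have s0 := root_elt_neq0 p_prime fP; have x0 := gen_elt_neq0 fP.
have sC := root_elt_comm fP; have xC := gen_elt_comm fP.
have xsC := gen_root_comm fP; have xsN := gen_root_anti fP.
have s2 i : center (root_elt fP i * root_elt fP i).
  by apply: Linfty_central; rewrite rmorphM; exact: embK_sqr_baseF.
have x2 i : center (gen_elt fP i * gen_elt fP i).
  by apply: Linfty_central; rewrite rmorphM; exact: embG_sqr_baseF.
have ex := @Linfty_exhaust _ _ _ fP.
split.
- exact: tower_locally_finite ex.
- exact: tower_strongly_algebraic ex.
- exact: tower_not_linear x0 xsC xsN.
Qed.
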